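(* Let $K$ be an infinite field, let $R=K[x_1,\ldots,x_n]$ ($n\ge 1$) be the polynomial ring with the standard grading, let $I$ be a graded ideal of $R$, and let $t_0,t_1,\ldots,t_{n-1}$ be the $t$-sequence of $I$. Set $B(I)=t_0+t_1+\cdots+t_{n-1}$. Then the following conditions are equivalent: (i) $I$ is a completely $\mathfrak m$-full ideal; (ii) $\mu(I)=B(I)$.
   Context: $\mathfrak m=(x_1,\ldots,x_n)$ is the graded maximal ideal, $l$ denotes length, and $\mu(I)=l(I/\mathfrak m I)$ is the minimal number of generators of a graded ideal $I$. For an ideal $J$ and an element $z$, $J:z$ is the colon ideal. ''General linear form(s)'' means: for all choices in some nonempty Zariski open subset of the space of linear forms (respectively of tuples of linear forms). Completely $\mathfrak m$-full ideals are defined recursively on the number $n$ of variables. (1) If $n=0$ (so $R=K$), the completely $\mathfrak m$-full ideal is the zero ideal. (2) If $n>0$, a graded ideal $I$ of $R$ is completely $\mathfrak m$-full if, for a general linear form $z$ in $R$, one has $\mathfrak m I:z=I$ and $(I+zR)/zR$ is completely $\mathfrak m$-full as an ideal of $R/zR$ (a polynomial ring in $n-1$ variables over $K$). $t$-value: for a graded ideal $J$ of a polynomial ring $A$ in finitely many (at least one) variables over $K$, the $t$-value of $J$ is $t(J)=\min\{\,l((J:y)/J)\mid y \text{ a linear form of } A\,\}$; this is finite and equals $l((J:y)/J)$ for a general linear form $y$. $t$-sequence: let $z_1,\ldots,z_n$ be general linear forms generating $\mathfrak m$, put $R^{(i)}=R/(z_{i+1},z_{i+2},\ldots,z_n)R$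 for $0\le i\le n-1$ and $R^{(n)}=R$. Then $t_i=t_i(I)$ is the $t$-value of the ideal $IR^{(i+1)}$ of $R^{(i+1)}$, for $i=0,1,\ldots,n-1$. The sequence $t_0,\ldots,t_{n-1}$ does not depend on the choice of the general linear forms and is called the $t$-sequence of $I$. *)

(* Defs.v *)
From HB Require Import structures.
From mathcomp Require Import all_boot all_order all_algebra.
From mathcomp Require Import boolp classical_sets cardinality.
From mathcomp Require Import mpoly.

Set Implicit Arguments.
Unset Strict Implicit.
Unset Printing Implicit Defensive.

Import GRing.Theory.
Local Open Scope ring_scope.
Local Open Scope classical_set_scope.

Definition is_ideal (A : comNzRingType) (J : set A) : Prop :=
  [/\ J 0, (forall p q, J p -> J q -> J (p + q))
    & (forall a p, J p -> J (a * p))].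

Definition ideal_gen (A : comNzRingType) (S : set A) : set A :=
  smallest (@is_ideal A) S.

Definition ideal_mul (A : comNzRingType) (I J : set A) : set A :=
  ideal_gen [set p | exists a b, [/\ I a, J b & p = a * b]].

Definition colon (A : comNzRingType) (J : set A) (z : A) : set A :=
  [set p | J (p * z)].

(* The submodules of M / N are the J / N for J an ideal with N <= J <= M,
   so chains of submodules are chains of ideals between N and M. *)
Definition ideal_chain (A : comNzRingType) (N M : set A) (l : nat) : Prop :=
  exists J : nat -> set A,
    [/\ J 0%N = N, J l = M,
        (forall k, (k <= l)%N -> is_ideal (J k))
      & (forall k, (k < l)%N -> J k `<` J k.+1)].

(* [is_length N M l]: the A-module M / N has finite length, equal to l.
   It holds for no l when M / N has infinite length. *)
Definition is_length (A : comNzRingType) (N M : set A) (l : nat) : Prop :=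
  ideal_chain N M l /\ (forall k, ideal_chain N M k -> (k <= l)%N).

Section PolynomialRing.
Variable K : fieldType.

Definition max_ideal (n : nat) : set {mpoly K[n]} :=
  ideal_gen (range (fun i : 'I_n => 'X_i : {mpoly K[n]})).

Definition graded_ideal (n : nat) (I : set {mpoly K[n]}) : Prop :=
  is_ideal I /\ (forall (d : nat) p, I p -> I (pihomog mdeg d p)).

(* Linear forms are parametrised by their coefficient vectors. *)
Definition lform (n : nat) (a : 'rV[K]_n) : {mpoly K[n]} :=
  \sum_(j < n) a 0 j *: 'X_j.

Definition zariski_open (r n : nat) (U : set 'M[K]_(r, n)) : Prop :=
  exists F : set {mpoly K[r * n]},
    U = [set Z | exists2 f, F f & f.@[fun k => mxvec Z 0 k] != 0].

(* [generic P]: P holds for general r-tuples of linear forms in n variables,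
   the k-th form of the tuple Z being [lform (row k Z)]. *)
Definition generic (r n : nat) (P : 'M[K]_(r, n) -> Prop) : Prop :=
  exists U : set 'M[K]_(r, n),
    [/\ zariski_open U, U !=set0 & forall Z, U Z -> P Z].

(* phi exhibits the polynomial ring in m variables as the standard graded
   K-algebra K[x_1, ..., x_n] / L.  The ideal (I + L) / L is then phi @` I. *)
Definition graded_quotient (n m : nat) (L : set {mpoly K[n]})
    (phi : {mpoly K[n]} -> {mpoly K[m]}) : Prop :=
  [/\ range phi = setT, phi @^-1` [set 0] = L
    & forall (d : nat) p, p \is d.-homog -> phi p \is d.-homog].

(* At n > 0, the choice of the identification phi of R / zR with a polynomial
   ring is immaterial: two choices differ by a graded automorphism. *)
Fixpoint completely_m_full (n : nat) : set {mpoly K[n]} -> Prop :=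
  match n return set {mpoly K[n]} -> Prop with
  | 0%N => fun I => I = [set 0]
  | n'.+1 => fun I =>
      graded_ideal I /\
      generic (fun a : 'rV[K]_n'.+1 =>
        let z := lform a in
        colon (ideal_mul (@max_ideal n'.+1) I) z = I /\
        exists phi : {lrmorphism {mpoly K[n'.+1]} -> {mpoly K[n']}},
          graded_quotient (ideal_gen [set z]) phi /\
          completely_m_full (phi @` I))
  end.

Definition is_mu (n : nat) (I : set {mpoly K[n]}) (k : nat) : Prop :=
  is_length (ideal_mul (@max_ideal n) I) I k.

(* Forms y with (J : y) / J of infinite length do not contribute to the
   minimum.  Allowing y = 0 is harmless: J : 0 contains every J : y. *)
Definition is_t_value (n : nat) (J : set {mpoly K[n]}) (t : nat) : Prop :=
  (exists a : 'rV[K]_n, is_length J (colon J (lform a)) t) /\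
  (forall (a : 'rV[K]_n) l, is_length J (colon J (lform a)) l -> (t <= l)%N).

(* With rows indexed from 0, the i-th ring is the quotient of R by the forms
   of index k > i, a polynomial ring in i + 1 variables. *)
Definition is_t_sequence (n : nat) (I : set {mpoly K[n]}) (t : 'I_n -> nat) :
    Prop :=
  generic (fun Z : 'M[K]_(n, n) =>
    ideal_gen (range (fun k : 'I_n => lform (row k Z))) = @max_ideal n /\
    forall i : 'I_n,
      exists phi : {lrmorphism {mpoly K[n]} -> {mpoly K[i.+1]}},
        graded_quotient
          (ideal_gen [set lform (row k Z) | k in [set k : 'I_n | (i < k)%N]])
          phi /\
        is_t_value (phi @` I) (t i)).

End PolynomialRing.

(* Main.v *)
(* For a linear form z, comparing I/mI with its image in R/zR gives the exact
   formula
     mu(I) = mu((I+zR)/zR) + l((I:z)/(mI:z)),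
   and mI:z contains I.  When l((I:z)/I) is finite, mu(I) is therefore at most
   mu((I+zR)/zR) + l((I:z)/I), with equality exactly when mI:z = I.  For
   general z the second term is the last t-value and the t-sequence of
   (I+zR)/zR consists of the others, so induction on the number of variables
   shows that a proper I has mu(I) <= B(I), with equality exactly when I is
   completely m-full.  For I = R both conditions fail.

   That l((I:z)/I) takes its minimum for general z is a semicontinuity argument:
   if y attains the minimum, let N be the stable value of I : y^j.  It has
   finite length over I, and y avoids the finitely many associated primes of
   R/N, hence so does a general z.  Then (I:z)/I is the kernel of z on N/I, a
   finite-dimensional space on which z acts by a matrix with entries linear
   in the coefficients of z. *)
Require Import Defs.
From HB Require Import structures.
From mathcomp Require Import all_boot all_order all_algebra.
From mathcomp Require Import boolp classical_sets cardinality.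
From mathcomp Require Import mpoly.

Set Implicit Arguments.
Unset Strict Implicit.
Unset Printing Implicit Defensive.

Import Order.TTheory GRing.Theory.
Local Open Scope ring_scope.
Local Open Scope classical_set_scope.

(** * Lengths of intervals in modular classes of subsets *)

(** The length formula comes from inserting mI + (I ∩ zR) between mI and I: the upper part has
    length mu of the image, and multiplication by z identifies the lower part with (I:z)/(mI:z).
    Quotient modules are not formed: a length belongs to an interval of ideals, and module
    isomorphisms become order isomorphisms of intervals.

    The semicontinuity argument compares R-lengths with ranks over K. They agree because, for graded
    ideals with finite length between them, the variables act nilpotently on the quotient. N has
    finite length over I because multiplication by y embeds each (I:y^(k+2))/(I:y^(k+1)) into the
    step before it.

    The obstacle in the induction is that the t-sequence is given by one generic condition on
    n-tuples of forms of R, while the quotient requires one on (n-1)-tuples of forms of R/zR.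
    Freezing all but the last form of a good tuple yields the general z; for such a z, tuples of
    R/zR are lifted to R by a map affine in their coefficients, so that the open condition can be
    pulled back. *)

(* [chain] and [len] are convertible to [ideal_chain] and [is_length] when C is
   the class of ideals; they are also used for linear subspaces. *)
Definition chain (T : Type) (C : set T -> Prop) (N M : set T) (l : nat) : Prop :=
  exists J : nat -> set T,
    [/\ J 0%N = N, J l = M,
        (forall k, (k <= l)%N -> C (J k))
      & (forall k, (k < l)%N -> J k `<` J k.+1)].

Definition len (T : Type) (C : set T -> Prop) (N M : set T) (l : nat) : Prop :=
  chain C N M l /\ (forall k, chain C N M k -> (k <= l)%N).

Definition sumset (T : zmodType) (J L : set T) : set T :=
  [set p | exists a b, [/\ J a, L b & p = a + b]].

Definition modular_class (T : zmodType) (C : set T -> Prop) : Prop :=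
  [/\ (forall J, C J -> J 0), (forall J p q, C J -> J p -> J q -> J (p - q)),
      (forall J L, C J -> C L -> C (J `&` L))
    & (forall J L, C J -> C L -> C (sumset J L))].

Section Chains.
Variables (T : Type) (C : set T -> Prop).
Implicit Types (N M L : set T) (J : nat -> set T).

Lemma nested J l : (forall k, (k < l)%N -> J k `<=` J k.+1) ->
  forall i j, (i <= j <= l)%N -> J i `<=` J j.
Proof.
move=> hJ i j /andP[]; elim: j => [|j IH]; first by rewrite leqn0 => /eqP-> _ x.
rewrite leq_eqVlt => /orP[/eqP-> _ x //|ij jl].
exact: subset_trans (IH ij (ltnW jl)) (hJ _ jl).
Qed.

Lemma chainC N M l : chain C N M l -> C N /\ C M.
Proof. by case=> J [<- <- h _]; split; apply: h. Qed.

Lemma chain_nested N M l : chain C N M l -> exists J : nat -> set T,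
    [/\ J 0%N = N, J l = M,
        (forall k, (k <= l)%N -> C (J k)),
        (forall k, (k < l)%N -> J k `<` J k.+1)
      & (forall i j, (i <= j <= l)%N -> J i `<=` J j)].
Proof.
case=> J [h0 hl hC hJ]; exists J; split=> //.
exact: (nested (fun k hk => properW (hJ k hk))).
Qed.

Lemma chain_sub N M l : chain C N M l -> N `<=` M.
Proof. by case/chain_nested=> J [<- <- _ _]; apply; rewrite leq0n leqnn. Qed.

Lemma chain0 N : C N -> chain C N N 0.
Proof. by move=> h; exists (fun=> N); split. Qed.

Lemma chain1 N M : C N -> C M -> N `<` M -> chain C N M 1.
Proof.
move=> hN hM NM; exists (fun i => if i == 0%N then N else M).
by split=> //; case=> // k.
Qed.

Lemma chain_cat N L M a b :
  chain C N L a -> chain C L M b -> chain C N M (a + b).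
Proof.
move=> [J [J0 Ja JC JS]] [G [G0 Gb GC GS]].
exists (fun i => if (i <= a)%N then J i else G (i - a)%N); split.
- by rewrite leq0n.
- case: ifP => h; last by rewrite addKn.
  have b0 : b = 0%N by move: h; rewrite -{2}[a]addn0 leq_add2l leqn0 => /eqP.
  by rewrite b0 addn0 Ja -G0 -{1}b0 Gb.
- move=> k hk; case: ifP => h; first exact: JC.
  by apply: GC; rewrite leq_subLR.
- move=> k hk; case: (ltngtP k a) => h.
  + by apply: JS.
  + rewrite subSn; last exact: ltnW.
    by apply: GS; rewrite ltn_subLR // ltnW.
  + by rewrite h subSnn Ja -G0; apply: GS; move: hk; rewrite h -{1}[a]addn0 ltn_add2l.
Qed.

(** Deleting the repetitions of a weakly increasing family leaves a chain whose length is the number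
    of strict steps. *)
Lemma chain_of_nested k J :
  (forall i, (i <= k)%N -> C (J i)) ->
  (forall i, (i < k)%N -> J i `<=` J i.+1) ->
  chain C (J 0%N) (J k) (\sum_(i < k) `[< J i <> J i.+1 >])%N.
Proof.
elim: k => [|k IH] hC hJ; first by rewrite big_ord0; apply: chain0; apply: hC.
rewrite big_ord_recr /=; apply: chain_cat.
  by apply: IH => i hi; [apply: hC; apply: leqW|apply: hJ; apply: leqW].
case: asboolP => h /=.
  apply: chain1; [exact: hC|exact: hC|].
  by rewrite properEneq; split; [apply/eqP|exact: hJ].
move/contrapT: h => ->; exact/chain0/hC.
Qed.

Lemma len_exists N M b : C N -> C M -> N `<=` M ->
  (forall k, chain C N M k -> (k <= b)%N) -> exists2 l, (l <= b)%N & len C N M l.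
Proof.
move=> hN hM NM hb.
have ex : exists k, `[< chain C N M k >].
  case: (pselect (N = M)) => [<-|ne]; first by exists 0%N; apply/asboolP/chain0.
  by exists 1%N; apply/asboolP/chain1 => //; rewrite properEneq; split => //; apply/eqP.
have ub k : `[< chain C N M k >] -> (k <= b)%N by move/asboolP/hb.
case: (ex_maxnP ex ub) => l /asboolP hl hmax; exists l; first exact: hb.
by split=> // k hk; apply: hmax; apply/asboolP.
Qed.

Lemma lenC N M l : len C N M l -> C N /\ C M.
Proof. by case=> /chainC. Qed.

Lemma len_sub N M l : len C N M l -> N `<=` M.
Proof. by case=> /chain_sub. Qed.

Lemma len_uniq N M l k : len C N M l -> len C N M k -> l = k.
Proof.
by move=> [c h] [c' h']; apply/eqP; rewrite eqn_leq h' ?h.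
Qed.

Lemma len0 N M : len C N M 0 -> N = M.
Proof. by case=> -[J [<- <-]]. Qed.

Lemma len_refl N : C N -> len C N N 0.
Proof.
move=> hN; split; first exact: chain0.
case=> // k /chain_nested[J [J0 Jk _ JS Jn]].
have := JS 0%N isT; rewrite J0 => -[h []].
by rewrite -[X in _ `<=` X]Jk; apply: Jn; rewrite leqnn.
Qed.

End Chains.

Section ChainMap.
Variables (T T' : Type) (C : set T -> Prop) (C' : set T' -> Prop).
Variables (F : set T -> set T') (N M : set T).
Hypothesis FC : forall J, C J -> N `<=` J -> J `<=` M -> C' (F J).
Hypothesis FS : forall J L, C J -> C L -> N `<=` J -> L `<=` M ->
  J `<` L -> F J `<` F L.

Lemma chain_map l : chain C N M l -> chain C' (F N) (F M) l.
Proof.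
case/chain_nested=> J [J0 Jl hC JS Jn].
have NJ i : (i <= l)%N -> N `<=` J i by move=> hi; rewrite -J0; apply: Jn.
have JM i : (i <= l)%N -> J i `<=` M by move=> hi; rewrite -Jl; apply: Jn; rewrite hi /=.
exists (F \o J); rewrite /= J0 Jl; split=> // k hk.
  by apply: FC; [exact: hC|exact: NJ|exact: JM].
by apply: FS; [apply: hC; exact: ltnW|exact: hC|apply: NJ; exact: ltnW|exact: JM|exact: JS].
Qed.

End ChainMap.

(** Mutually inverse monotone maps between two intervals carry strict chains to strict chains. This
    plays the role of an isomorphism of quotient modules. *)
Lemma len_iso (T T' : Type) (C : set T -> Prop) (C' : set T' -> Prop)
    (F : set T -> set T') (G : set T' -> set T) (N M : set T) (N' M' : set T') :
  F N = N' -> F M = M' -> N `<=` M ->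
  (forall J, C J -> N `<=` J -> J `<=` M -> C' (F J) /\ G (F J) = J) ->
  (forall J, C' J -> N' `<=` J -> J `<=` M' -> C (G J) /\ F (G J) = J) ->
  {homo F : J L / J `<=` L} -> {homo G : J L / J `<=` L} ->
  C N -> C M ->
  forall l, len C N M l <-> len C' N' M' l.
Proof.
move=> FN FM NM hF hG mF mG CN CM.
have GN : G N' = N by rewrite -FN; apply: (hF N _ _ _).2.
have GM : G M' = M by rewrite -FM; apply: (hF M _ _ _).2.
have NM' : N' `<=` M' by rewrite -FN -FM; apply: mF.
have up l : chain C N M l -> chain C' N' M' l.
  rewrite -FN -FM; apply: chain_map => [J cJ NJ JM|J L cJ cL NJ LM].
    exact: (hF J _ _ _).1.
  move=> [JL LJ]; split; first exact: mF.
  move=> /mG; rewrite (hF J _ _ _).2 ?(hF L _ _ _).2 //.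
    exact: subset_trans NJ JL.
  exact: subset_trans JL LM.
have dn l : chain C' N' M' l -> chain C N M l.
  rewrite -GN -GM; apply: chain_map => [J cJ NJ JM|J L cJ cL NJ LM].
    exact: (hG J _ _ _).1.
  move=> [JL LJ]; split; first exact: mG.
  move=> /mF; rewrite (hG J _ _ _).2 ?(hG L _ _ _).2 //.
    exact: subset_trans NJ JL.
  exact: subset_trans JL LM.
by move=> l; split=> -[c h]; split; [exact: up|move=> k /dn; exact: h
  |exact: dn|move=> k /up; exact: h].
Qed.

(** * Additivity of length, from the modular law *)

Section Modular.
Variables (T : zmodType) (C : set T -> Prop) (hC : modular_class C).
Implicit Types (N M L : set T).

Lemma sumsetl J L : C L -> J `<=` sumset J L.
Proof. by case: hC => h0 _ _ _ cL p hp; exists p, 0; split; [|exact: h0|rewrite addr0]. Qed.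

Lemma sumsetr J L : C J -> L `<=` sumset J L.
Proof. by case: hC => h0 _ _ _ cL p hp; exists 0, p; split; [exact: h0| |rewrite add0r]. Qed.

Lemma class_add J p q : C J -> J p -> J q -> J (p + q).
Proof.
case: hC => h0 hB _ _ cJ hp hq; rewrite -[q]opprK; apply: (hB _ _ _ cJ hp).
by rewrite -[- q]add0r; apply: hB => //; exact: h0.
Qed.

Lemma sumset_sub J L M : C M -> J `<=` M -> L `<=` M -> sumset J L `<=` M.
Proof. by move=> cM JM LM p [a [b [/JM ha /LM hb ->]]]; exact: class_add. Qed.

Lemma modular_eq J J' L : C J -> C J' -> C L -> J `<=` J' ->
  J `&` L = J' `&` L -> sumset J L = sumset J' L -> J = J'.
Proof.
case: (hC) => h0 hB _ _ cJ cJ' cL JJ' eI eS.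
apply/seteqP; split=> // p hp.
have [a [b [ha hb pE]]] : sumset J L p by rewrite eS; exact: sumsetl hp.
rewrite pE; apply: class_add => //.
have : (J' `&` L) b by split=> //; rewrite -[b](addKr a) -pE addrC; apply: hB => //; exact: JJ'.
by rewrite -eI => -[].
Qed.

(** Cut the chain with L and add L to it. By the modular law every strict step stays strict in at
    least one of the two resulting families, so their strict steps number at least k. *)
Lemma chain_split N L M k : C L -> N `<=` L -> L `<=` M -> chain C N M k ->
  exists a b, [/\ chain C N L a, chain C L M b & (k <= a + b)%N].
Proof.
move=> cL NL LM /chain_nested[J [J0 Jk JC JS Jn]].
case: (hC) => h0 hB hI hS.
have mono i : (i < k)%N -> J i `<=` J i.+1 by move/JS/properW.
have c1 := @chain_of_nested _ C k (fun i => J i `&` L)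
  (fun i hi => hI _ _ (JC i hi) cL) 
  (fun i hi x xi => conj (mono i hi x xi.1) xi.2).
have mS i : (i < k)%N -> sumset (J i) L `<=` sumset (J i.+1) L.
  by move=> hi p [a [b [ha hb ->]]]; exists a, b; split=> //; exact: mono ha.
have c2 := @chain_of_nested _ C k (fun i => sumset (J i) L)
  (fun i hi => hS _ _ (JC i hi) cL) mS.
move: c1 c2; rewrite /= J0 Jk (setIidl NL) (setIidr LM).
have -> : sumset N L = L.
  by apply/seteqP; split; [exact: sumset_sub|apply: sumsetr; rewrite -J0; exact: JC].
have -> : sumset M L = M.
  have cM : C M by rewrite -Jk; exact: JC.
  by apply/seteqP; split; [exact: sumset_sub|exact: sumsetl].
move=> c1 c2; eexists; eexists; split; [exact: c1|exact: c2|].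
rewrite -big_split /= -[k in (k <= _)%N]card_ord -sum1_card leq_sum // => i _.
case: asboolP => //= /contrapT eI; case: asboolP => //= /contrapT eS.
have := JS i (ltn_ord i); rewrite (modular_eq _ _ cL _ eI eS) => [[]//|||]; try exact: mono.
  by apply: JC; apply: ltnW.
exact: JC.
Qed.

Lemma len_le_add N L M a b : C L -> N `<=` L -> L `<=` M ->
  (forall k, chain C N L k -> (k <= a)%N) ->
  (forall k, chain C L M k -> (k <= b)%N) ->
  forall k, chain C N M k -> (k <= a + b)%N.
Proof.
move=> cL NL LM ha hb k /(chain_split cL NL LM)[x [y [/ha hx /hb hy]]] /leq_trans; apply.
exact: leq_add.
Qed.

Lemma len_add N L M a b : len C N L a -> len C L M b -> len C N M (a + b).
Proof.
move=> h1 h2; split; first exact: chain_cat h1.1 h2.1.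
apply: len_le_add (lenC h1).2 (len_sub h1) (len_sub h2) h1.2 h2.2.
Qed.

Lemma len_split N L M c : C L -> N `<=` L -> L `<=` M -> len C N M c ->
  exists a b, [/\ len C N L a, len C L M b & (a + b)%N = c].
Proof.
move=> cL NL LM h; have [cN cM] := lenC h.
have [k0 ck0] : exists k, chain C L M k.
  have [a [b [_ hb _]]] := chain_split cL NL LM h.1; by exists b.
have [k1 ck1] : exists k, chain C N L k.
  have [a [b [ha _ _]]] := chain_split cL NL LM h.1; by exists a.
have [a _ ha] : exists2 l, (l <= c)%N & len C N L l.
  apply: len_exists => // k ck; apply: leq_trans (h.2 _ (chain_cat ck ck0)).
  exact: leq_addr.
have [b _ hb] : exists2 l, (l <= c)%N & len C L M l.
  apply: len_exists => // k ck; apply: leq_trans (h.2 _ (chain_cat ck1 ck)).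
  exact: leq_addl.
by exists a, b; split=> //; apply: len_uniq (len_add ha hb) h.
Qed.

(** Choose a term of least length over N. Every later term lies inside it and cannot be shorter, so
    it is equal to it. *)
Lemma len_stable N M l (D : nat -> set T) : len C N M l ->
  (forall d, [/\ C (D d), N `<=` D d & D d `<=` M]) ->
  (forall d, D d.+1 `<=` D d) ->
  exists d0, forall d, (d0 <= d)%N -> D d = D d0.
Proof.
move=> h hD dec.
have hL d : exists a, `[< len C N (D d) a >].
  have [cD ND DM] := hD d.
  by have [a [b [ha _ _]]] := len_split cD ND DM h; exists a; apply/asboolP.
have ex : exists a, `[< exists d, len C N (D d) a >].
  by have [a /asboolP ha] := hL 0%N; exists a; apply/asboolP; exists 0%N.
case: (ex_minnP ex) => a /asboolP[d0 hd0] hmin; exists d0 => d hd.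
have sub : D d `<=` D d0.
  elim: d hd => [|d IH]; first by rewrite leqn0 => /eqP-> x.
  rewrite leq_eqVlt => /orP[/eqP-> x //|/IH]; exact: subset_trans.
have [cD ND DM] := hD d.
have [a1 [b [ha1 hb ab]]] := len_split cD ND sub hd0.
have : (a <= a1)%N by apply: hmin; apply/asboolP; exists d.
rewrite -ab -{2}[a1]addn0 leq_add2l leqn0 => /eqP b0.
by move: hb; rewrite b0 => /len0.
Qed.

End Modular.

(** * Ideals, homogeneous polynomials and linear forms *)

Section Ideals.
Variable A : comNzRingType.
Implicit Types (I J L S : set A) (p q z : A).

Lemma ideal0 J : is_ideal J -> J 0. Proof. by case. Qed.

Lemma idealD J p q : is_ideal J -> J p -> J q -> J (p + q).
Proof. by case=> _ h _; apply: h. Qed.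

Lemma idealM J p q : is_ideal J -> J q -> J (p * q).
Proof. by case=> _ _ h; apply: h. Qed.

Lemma idealMr J p q : is_ideal J -> J p -> J (p * q).
Proof. by rewrite mulrC; apply: idealM. Qed.

Lemma idealN J p : is_ideal J -> J p -> J (- p).
Proof. by move=> hJ hp; rewrite -mulN1r; apply: idealM. Qed.

Lemma idealB J p q : is_ideal J -> J p -> J q -> J (p - q).
Proof. by move=> hJ hp hq; apply: idealD => //; apply: idealN. Qed.

Lemma ideal_sum J (T : Type) (r : seq T) (P : pred T) (F : T -> A) :
  is_ideal J -> (forall i, P i -> J (F i)) -> J (\sum_(i <- r | P i) F i).
Proof.
move=> hJ h; elim/big_ind: _ => //; first exact: ideal0.
by move=> x y; apply: idealD.
Qed.

Lemma ideal1 J : is_ideal J -> J 1 -> J = setT.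
Proof. by move=> hJ h1; apply/seteqP; split=> // p _; rewrite -[p]mulr1; apply: idealM. Qed.

Lemma idealT : is_ideal (@setT A). Proof. by split. Qed.

Lemma idealI I J : is_ideal I -> is_ideal J -> is_ideal (I `&` J).
Proof.
move=> hI hJ; split; first by split; exact: ideal0.
  by move=> p q [? ?] [? ?]; split; apply: idealD.
by move=> p q [? ?]; split; apply: idealM.
Qed.

Lemma ideal_sumset I J : is_ideal I -> is_ideal J -> is_ideal (sumset I J).
Proof.
move=> hI hJ; split.
- by exists 0, 0; split; [exact: ideal0|exact: ideal0|rewrite addr0].
- move=> _ _ [a [b [ha hb ->]]] [c [d [hc hd ->]]]; exists (a + c), (b + d).
  by split; [exact: idealD|exact: idealD|rewrite addrACA].
- move=> p _ [a [b [ha hb ->]]]; exists (p * a), (p * b).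
  by split; [exact: idealM|exact: idealM|rewrite mulrDr].
Qed.

Lemma ideal_modular : modular_class (@is_ideal A).
Proof.
split; [exact: ideal0|exact: idealB|exact: idealI|exact: ideal_sumset].
Qed.

Lemma ideal_gen_ideal S : is_ideal (ideal_gen S).
Proof.
split=> [M [hM _]|p q hp hq M hMS|p q hq M hMS]; first exact: ideal0.
  by have [hM _] := hMS; apply: idealD => //; [exact: hp|exact: hq].
by have [hM _] := hMS; apply: idealM => //; exact: hq.
Qed.

Lemma sub_ideal_gen S : S `<=` ideal_gen S.
Proof. by move=> p hp M [_]; apply. Qed.

Lemma ideal_gen_sub S J : is_ideal J -> S `<=` J -> ideal_gen S `<=` J.
Proof. by move=> hJ SJ p; apply; split. Qed.

Lemma ideal_genS S S' : S `<=` S' -> ideal_gen S `<=` ideal_gen S'.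
Proof.
move=> h; apply: ideal_gen_sub; first exact: ideal_gen_ideal.
exact: subset_trans h (@sub_ideal_gen _).
Qed.

Lemma ideal_gen1 z p : ideal_gen [set z] p <-> exists r, p = r * z.
Proof.
split=> [|[r ->]]; last by apply: (idealM _ (@ideal_gen_ideal _)); exact: sub_ideal_gen.
suff h : ideal_gen [set z] `<=` [set p | exists r, p = r * z] by exact: h.
apply: ideal_gen_sub; last first.
  by move=> _ ->; exists 1; rewrite mul1r.
split; first by exists 0; rewrite mul0r.
  by move=> _ _ [r ->] [s ->]; exists (r + s); rewrite mulrDl.
by move=> s _ [r ->]; exists (s * r); rewrite mulrA.
Qed.

Lemma colon_ideal J z : is_ideal J -> is_ideal (colon J z).
Proof.
move=> hJ; rewrite /colon; split=> /= [|p q hp hq|p q hq].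
- by rewrite mul0r; exact: ideal0.
- by rewrite mulrDl; exact: idealD.
- by rewrite -mulrA; exact: idealM.
Qed.

Lemma sub_colon J z : is_ideal J -> J `<=` colon J z.
Proof. by move=> hJ p hp; rewrite /colon /=; exact: idealMr. Qed.

Lemma colonS J L z : J `<=` L -> colon J z `<=` colon L z.
Proof. by move=> h p /h. Qed.

Lemma ideal_mul_ideal I J : is_ideal (ideal_mul I J).
Proof. exact: ideal_gen_ideal. Qed.

Lemma ideal_mul_sub I J : is_ideal J -> ideal_mul I J `<=` J.
Proof.
by move=> hJ; apply: ideal_gen_sub => // _ [a [b [_ hb ->]]]; exact: idealM.
Qed.

Lemma mem_ideal_mul I J p q : I p -> J q -> ideal_mul I J (p * q).
Proof. by move=> hp hq; apply: sub_ideal_gen; exists p, q. Qed.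

End Ideals.

Section IdealImage.
Variables (A B : comNzRingType) (f : {rmorphism A -> B}).

Lemma preimage_ideal J : is_ideal J -> is_ideal (f @^-1` J).
Proof.
move=> hJ; split=> /= [|p q hp hq|p q hq].
- by rewrite rmorph0; exact: ideal0.
- by rewrite rmorphD; exact: idealD.
- by rewrite rmorphM; exact: idealM.
Qed.

Lemma image_ideal J : range f = setT -> is_ideal J -> is_ideal (f @` J).
Proof.
move=> fs hJ; split.
- by exists 0; [exact: ideal0|exact: rmorph0].
- by move=> _ _ [p hp <-] [q hq <-]; exists (p + q); [exact: idealD|exact: rmorphD].
- move=> b _ [q hq <-]; have [a _ <-] : range f b by rewrite fs.
  by exists (a * q); [exact: idealM|exact: rmorphM].
Qed.

Lemma image_ideal_gen (S : set A) : range f = setT ->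
  f @` ideal_gen S = ideal_gen (f @` S).
Proof.
move=> fs; apply/seteqP; split.
  move=> _ [p hp <-].
  apply: (ideal_gen_sub (preimage_ideal (@ideal_gen_ideal _ (f @` S))) _ hp).
  by move=> q hq; apply: sub_ideal_gen; exists q.
apply: ideal_gen_sub; first by apply: image_ideal => //; exact: ideal_gen_ideal.
by move=> _ [q hq <-]; exists q => //; exact: sub_ideal_gen.
Qed.

End IdealImage.

Section Subspaces.
Variables (K : fieldType) (V : lmodType K).

Definition subsp (J : set V) : Prop :=
  [/\ J 0, (forall p q, J p -> J q -> J (p + q))
    & (forall (c : K) p, J p -> J (c *: p))].

Lemma subspN J p : subsp J -> J p -> J (- p).
Proof. by case=> _ _ h hp; rewrite -scaleN1r; apply: h. Qed.

Lemma subsp_sum J (T : Type) (r : seq T) (P : pred T) (F : T -> V) :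
  subsp J -> (forall i, P i -> J (F i)) -> J (\sum_(i <- r | P i) F i).
Proof. by move=> [h0 hD _] h; elim/big_ind: _. Qed.

Lemma subsp_modular : modular_class subsp.
Proof.
split.
- by move=> J [].
- move=> J p q hJ hp hq; have := subspN hJ hq; case: hJ => _ h _; exact: h.
- move=> J L [h0 hD hZ] [g0 gD gZ]; split=> // [p q [? ?] [? ?]|c p [? ?]].
    by split; [exact: hD|exact: gD].
  by split; [exact: hZ|exact: gZ].
- move=> J L [h0 hD hZ] [g0 gD gZ]; split.
  + by exists 0, 0; split; rewrite ?addr0.
  + move=> _ _ [a [b [ha hb ->]]] [c [d [hc hd ->]]]; exists (a + c), (b + d).
    by split; [exact: hD|exact: gD|rewrite addrACA].
  + move=> p _ [a [b [ha hb ->]]]; exists (p *: a), (p *: b).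
    by split; [exact: hZ|exact: gZ|rewrite scalerDr].
Qed.

End Subspaces.

Section Polynomials.
Variables (K : fieldType).
Implicit Types (n d e : nat).

Lemma ideal_subsp n (J : set {mpoly K[n]}) : is_ideal J -> subsp J.
Proof.
move=> hJ; split; [exact: ideal0|by move=> p q; exact: idealD|].
by move=> c p hp; rewrite -mul_mpolyC; exact: idealM.
Qed.

Lemma pihomogM n d e (p q : {mpoly K[n]}) : q \is e.-homog ->
  pihomog mdeg (d + e) (p * q) = pihomog mdeg d p * q.
Proof.
move=> hq; pose k := maxn (msize p) d.+1.
rewrite {1}(pihomog_partitionE (mf := mdeg) (k := k) (p := p)) ?leq_maxl //.
have dk : (d < k)%N by rewrite leq_maxr.
rewrite mulr_suml linear_sum /= (bigD1 (Ordinal dk)) //= pihomog_dE; last first.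
  by apply: dhomogM => //; exact: pihomogP.
rewrite big1 ?addr0 // => i; rewrite -val_eqE /= => ne.
apply: (@pihomog_ne0 _ _ _ (i + e)%N); first by rewrite eqn_add2r.
by apply: dhomogM => //; exact: pihomogP.
Qed.

Lemma lformE n (a : 'rV[K]_n) (i : 'I_n) : (lform a)@_U_(i) = a 0 i.
Proof.
rewrite /lform raddf_sum /= (bigD1 i) //= mcoeffZ mcoeffXU eqxx mulr1.
by rewrite big1 ?addr0 // => j ji; rewrite mcoeffZ mcoeffXU (negbTE ji) mulr0.
Qed.

Lemma lform_inj n : injective (@lform K n).
Proof. by move=> a b e; apply/rowP=> i; rewrite -!lformE e. Qed.

Lemma lform_is_linear n (c : K) (a b : 'rV[K]_n) :
  lform (c *: a + b) = c *: lform a + lform b.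
Proof.
rewrite /lform scaler_sumr -big_split /=; apply: eq_bigr => i _.
by rewrite !mxE scalerDl scalerA.
Qed.

HB.instance Definition _ n := GRing.isLinear.Build K 'rV[K]_n {mpoly K[n]} _
  (@lform K n) (@lform_is_linear n).

Lemma lform_homog n (a : 'rV[K]_n) : lform a \is 1.-homog.
Proof. by apply: rpred_sum => i _; apply: rpredZ; rewrite dhomogX; apply/eqP; exact: mdeg1. Qed.

Lemma homog1_lform n (p : {mpoly K[n]}) : p \is 1.-homog ->
  p = lform (\row_i p@_U_(i)).
Proof.
move=> hp; apply/mpolyP => m; case: (boolP (mdeg m == 1%N)).
  by case/mdeg1P=> i /eqP->; rewrite lformE mxE.
by move=> h; rewrite !(@dhomog_nemf_coeff _ _ mdeg 1) //; exact: lform_homog.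
Qed.

Lemma lform_delta n (i : 'I_n) : lform (delta_mx 0 i : 'rV[K]_n) = 'X_i.
Proof.
rewrite /lform (bigD1 i) //= mxE !eqxx scale1r big1 ?addr0 // => j ji.
by rewrite mxE (negbTE ji) andbF scale0r.
Qed.

Lemma mcoeff0_X n (i : 'I_n) : ('X_i : {mpoly K[n]})@_0 = 0.
Proof. by rewrite mcoeffX mnm1_eq0. Qed.

Lemma mcoeff0_lform n (a : 'rV[K]_n) : (lform a)@_0 = 0.
Proof.
by rewrite /lform raddf_sum big1 //= => i _; rewrite mcoeffZ mcoeff0_X mulr0.
Qed.

Lemma mcoeff0_ideal n : is_ideal [set p : {mpoly K[n]} | p@_0 = 0].
Proof.
split=> /= [|p q hp hq|p q hq]; first exact: mcoeff0.
  by rewrite mcoeffD hp hq addr0.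
by rewrite rmorphM /= hq mulr0.
Qed.

(** Constants and variables generate the ring, which gives an induction along sums and products
    instead of monomial expansions. *)
Lemma mpoly_ind (n : nat) (P : {mpoly K[n]} -> Prop) :
  (forall c, P c%:MP) -> (forall i, P 'X_i) ->
  (forall p q, P p -> P q -> P (p + q)) ->
  (forall p q, P p -> P q -> P (p * q)) -> forall p, P p.
Proof.
move=> hC hX hD hM p; rewrite (mpolyE p).
apply: (big_ind P) => [||m _]; [by rewrite -mpolyC0; exact: hC|exact: hD|].
 rewrite -mul_mpolyC; apply: (hM); first exact: hC.
rewrite mpolyXE_id; apply: (big_ind P) => [||i _]; [by rewrite -mpolyC1; exact: hC|exact: hM|].
 elim: (m i) => [|k IH]; first by rewrite expr0 -mpolyC1; exact: hC.
by rewrite exprS; apply: hM.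
Qed.

Lemma max_idealE n : @max_ideal K n = [set p | p@_0 = 0].
Proof.
apply/seteqP; split.
  apply: ideal_gen_sub; first exact: mcoeff0_ideal.
  by move=> _ [i _ <-]; exact: mcoeff0_X.
suff h (p : {mpoly K[n]}) : max_ideal (p - (p@_0)%:MP).
  by move=> p /= p0; have := h p; rewrite p0 mpolyC0 subr0.
have hI : is_ideal (@max_ideal K n) by exact: ideal_gen_ideal.
elim/mpoly_ind: p.
- by move=> c; rewrite mcoeffC eqxx mulr1 subrr; exact: (ideal0 hI).
- by move=> i; rewrite mcoeff0_X mpolyC0 subr0; apply: sub_ideal_gen; exists i.
- by move=> p q hp hq; rewrite mcoeffD mpolyCD opprD addrACA; exact: (idealD hI hp hq).
- move=> p q hp hq; rewrite rmorphM /= mpolyCM.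
  have -> : p * q - (p@_0)%:MP * (q@_0)%:MP =
    (p - (p@_0)%:MP) * q + (p@_0)%:MP * (q - (q@_0)%:MP).
    by rewrite mulrBl mulrBr addrA subrK.
  exact: (idealD hI (idealMr _ hI hp) (idealM _ hI hq)).
Qed.

Lemma pihomog0E n (p : {mpoly K[n]}) : pihomog mdeg 0 p = (p@_0)%:MP.
Proof.
apply/mpolyP=> m; rewrite mcoeffC.
case: (eqVneq m 0%MM) => [->|m0].
  rewrite ?eqxx mulr1 [in RHS](pihomog_partitionE (mf := mdeg) (p := p) (leqnSn _)).
  rewrite (bigD1 ord0) //= mcoeffD [X in _ = _ + X](raddf_sum (mcoeff 0)) /=.
  rewrite [X in _ = _ + X]big1 ?addr0 // => i.
  rewrite -val_eqE /= => i0.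
  rewrite (dhomog_nemf_coeff (pihomogP mdeg i p)) //.
  by apply: contra i0 => /eqP <-; apply/eqP; exact: mdeg0.
rewrite ?(negbTE m0) mulr0 (dhomog_nemf_coeff (pihomogP mdeg 0 p)) //.
by apply: contra m0 => /eqP h; rewrite -mdeg_eq0; apply/eqP.
Qed.

(** The degree 0 component of an element of I is its constant term and lies in I; if it is nonzero,
    it is a unit. *)
Lemma graded_proper n (I : set {mpoly K[n]}) : graded_ideal I -> I <> setT ->
  I `<=` @max_ideal K n.
Proof.
move=> [hI gI] nT p hp; rewrite max_idealE /=; apply/eqP/negP => /negP p0.
apply: nT; apply: ideal1 => //.
have := gI 0%N p hp; rewrite pihomog0E => /(idealM ((p@_0)^-1)%:MP hI).
by rewrite -mpolyCM mulVf.
Qed.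

Lemma graded_colon n (I : set {mpoly K[n]}) (a : 'rV[K]_n) :
  graded_ideal I -> graded_ideal (colon I (lform a)).
Proof.
move=> [hI gI]; split; first exact: colon_ideal.
move=> d p; rewrite /colon /= -(pihomogM d p (lform_homog a)); exact: gI.
Qed.

Section GradedMorphism.
Variables (n m : nat) (phi : {lrmorphism {mpoly K[n]} -> {mpoly K[m]}}).
Hypothesis phi_homog : forall d p, p \is d.-homog -> phi p \is d.-homog.

Lemma graded_pihomog d p : phi (pihomog mdeg d p) = pihomog mdeg d (phi p).
Proof.
pose k := maxn (msize p) d.+1.
have pk : (msize p <= k)%N by rewrite leq_maxl.
have dk : (d < k)%N by rewrite leq_maxr.
have E := etrans (congr1 phi (pihomog_partitionE pk)) (linear_sum phi _ _ _).
rewrite E [RHS]linear_sum /= [RHS](bigD1 (Ordinal dk)) //= [X in _ = X + _]pihomog_dE; last first.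
  by apply: phi_homog; exact: pihomogP.
rewrite [X in _ = _ + X]big1 ?addr0 // => i; rewrite -val_eqE /= => ne.
by apply: (@pihomog_ne0 _ _ _ i) => //; apply: phi_homog; exact: pihomogP.
Qed.

Lemma lrmorphC c : phi c%:MP = c%:MP.
Proof. by rewrite -!alg_mpolyC linearZ /= rmorph1. Qed.

Lemma graded_mcoeff0 p : (phi p)@_0 = p@_0.
Proof.
have := graded_pihomog 0 p; rewrite !pihomog0E lrmorphC => /(congr1 (mcoeff 0)).
by rewrite !mcoeffC eqxx !mulr1.
Qed.

Lemma graded_lform a : exists b, phi (lform a) = lform b.
Proof. by eexists; apply: homog1_lform; apply: phi_homog; exact: lform_homog. Qed.

Lemma graded_image (I : set {mpoly K[n]}) : range phi = setT ->
  graded_ideal I -> graded_ideal (phi @` I).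
Proof.
move=> ps [hI gI]; split; first exact: image_ideal.
by move=> d _ [p hp <-]; exists (pihomog mdeg d p); [exact: gI|exact: graded_pihomog].
Qed.

Lemma graded_lift_lform (b : 'rV[K]_m) : range phi = setT ->
  exists a, phi (lform a) = lform b.
Proof.
move=> ps; have [p _ hp] : range phi (lform b) by rewrite ps.
have e := homog1_lform (pihomogP mdeg 1 p).
exists (\row_i (pihomog mdeg 1 p)@_U_(i)); rewrite -e.
by rewrite graded_pihomog hp pihomog_dE //; exact: lform_homog.
Qed.

Lemma image_max_mul (I : set {mpoly K[n]}) : range phi = setT -> is_ideal I ->
  phi @` ideal_mul (@max_ideal K n) I = ideal_mul (@max_ideal K m) (phi @` I).
Proof.
move=> ps hI; rewrite image_ideal_gen //; congr ideal_gen; apply/seteqP; split.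
  move=> _ [_ [a [b [ha hb ->]]] <-]; exists (phi a), (phi b); split.
  - by move: ha; rewrite !max_idealE /= graded_mcoeff0.
  - by exists b.
  - exact: rmorphM.
move=> _ [a [_ [ha [b hb <-] ->]]]; have [c _ hc] : range phi a by rewrite ps.
exists (c * b); last by rewrite rmorphM /= hc.
exists c, b; split=> //.
by move: ha; rewrite -hc !max_idealE /= graded_mcoeff0.
Qed.

End GradedMorphism.

End Polynomials.

(** * Quotients by a linear form *)

Section LengthTransport.
Variable A : comNzRingType.
Implicit Types (N M J : set A) (z : A).

(** Multiplication by z maps M:z onto the multiples of z in M and pulls N back to N:z, so
    (M:z)/(N:z) is isomorphic to (N + (M ∩ zR))/N. *)
Lemma len_colon N M z q : is_ideal N -> is_ideal M -> N `<=` M ->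
  len (@is_ideal A) (colon N z) (colon M z) q <->
  len (@is_ideal A) N (sumset N (M `&` ideal_gen [set z])) q.
Proof.
move=> hN hM NM.
have hz J : is_ideal J -> is_ideal [set p | exists2 x, J x & p = x * z].
  move=> hJ; split; first by exists 0; [exact: ideal0|rewrite mul0r].
    by move=> _ _ [x hx ->] [y hy ->]; exists (x + y); [exact: idealD|rewrite mulrDl].
  by move=> a _ [x hx ->]; exists (a * x); [exact: idealM|rewrite mulrA].
apply: (@len_iso _ _ _ _ (fun J => sumset N [set p | exists2 x, J x & p = x * z])
  (fun J => colon J z)).
- apply/seteqP; split; last by apply: (sumsetl (@ideal_modular A)); apply: hz; exact: colon_ideal.
  by apply: (sumset_sub (@ideal_modular A)) => // _ [x hx ->].
- apply/seteqP; split=> _ [a [b [ha hb ->]]]; exists a, b; split=> //.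
    by case: hb => x hx ->; split=> //; apply/ideal_gen1; exists x.
  by case: hb => hb /ideal_gen1[x xE]; exists x; rewrite // /colon /= -xE.
- exact: colonS.
- move=> J hJ NJ JM; split; first by apply: ideal_sumset => //; exact: hz.
  apply/seteqP; split=> [x [n [_ [hn [y hy ->] e]]]|x hx]; last first.
    by exists 0, (x * z); split; [exact: ideal0|exists x|rewrite add0r].
  rewrite -(subrK y x); apply: idealD => //; apply: NJ.
  by rewrite /colon /= mulrBl e addrK.
- move=> J hJ NJ JM; split; first exact: colon_ideal.
  apply/seteqP; split; first by apply: (sumset_sub (@ideal_modular A)) => // _ [x hx ->].
  move=> y hy; have [n [_ [hn [_ /ideal_gen1[r ->]] e]]] := JM _ hy.
  exists n, (r * z); split=> //; exists r => //; rewrite /colon /=.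
  by rewrite -[r * z](addKr n) -e addrC; apply: idealB => //; exact: NJ.
- by move=> J L JL _ [n [_ [hn [x hx ->] ->]]]; exists n, (x * z); split=> //; exists x => //; exact: JL.
- by move=> J L; exact: colonS.
- exact: colon_ideal.
- exact: colon_ideal.
Qed.

Lemma len_image (B : comNzRingType) (f : {rmorphism A -> B}) N M k :
  range f = setT -> is_ideal N -> is_ideal M -> N `<=` M ->
  M `&` f @^-1` [set 0] `<=` N ->
  len (@is_ideal A) N M k <-> len (@is_ideal B) (f @` N) (f @` M) k.
Proof.
move=> fs hN hM NM ker.
refine (@len_iso A B (@is_ideal A) (@is_ideal B) (fun J => f @` J) (fun L => M `&` f @^-1` L) N M (f @` N) (f @` M) _ _ _ _ _ _ _ _ _ k) => //.
- move=> J hJ NJ JM; split; first exact: image_ideal.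
  apply/seteqP; split=> [x [hx [y hy e]]|x hx]; last by split; [exact: JM|exists x].
  rewrite -(subrK y x); apply: idealD => //; apply: NJ; apply: ker; split.
    by apply: idealB => //; exact: JM.
  by rewrite /= rmorphB /= e subrr.
- move=> L hL NL LM; split; first by apply: idealI => //; exact: preimage_ideal.
  apply/seteqP; split=> [_ [x [_ hx] <-] //|y hy].
  by have [x hx xy] := LM _ hy; exists x => //; split=> //=; rewrite xy.
- by move=> J L JL; exact: image_subset.
- by move=> L L' LL' x [hx /LL']; split.
Qed.

End LengthTransport.

Section Quotients.
Variable K : fieldType.
Implicit Types (n m : nat).

(** The ideal [A] between mI and I has the same image under phi as mI, namely m phi(I), and contains
    the part of I killed by phi. So I/A computes mu of phi(I), and [len_colon] computes A/mI. The
    equivalence also transports finiteness both ways. *)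
Lemma mu_split n m (I : set {mpoly K[n]}) (a : 'rV[K]_n)
    (phi : {lrmorphism {mpoly K[n]} -> {mpoly K[m]}}) (c : nat) :
  is_ideal I -> graded_quotient (ideal_gen [set lform a]) phi ->
  is_mu I c <-> exists k q, [/\ is_mu (phi @` I) k,
    is_length (colon (ideal_mul (@max_ideal K n) I) (lform a)) (colon I (lform a)) q
    & (k + q)%N = c].
Proof.
move=> hI [ps pk ph]; set mI := ideal_mul _ I; set z := lform a.
have hmI : is_ideal mI by exact: ideal_mul_ideal.
have mII : mI `<=` I by exact: ideal_mul_sub.
have hz := @ideal_gen_ideal _ [set z].
pose A := sumset mI (I `&` ideal_gen [set z]).
have hA : is_ideal A by apply: ideal_sumset => //; exact: idealI.
have AI : A `<=` I by apply: (sumset_sub (@ideal_modular _)) => // p [].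
have mA : mI `<=` A by apply: (sumsetl (@ideal_modular _)); exact: idealI.
have e1 q : is_length (colon mI z) (colon I z) q <-> len (@is_ideal _) mI A q.
  exact: len_colon.
have e2 k : is_mu (phi @` I) k <-> len (@is_ideal _) A I k.
  have -> : len (@is_ideal _) A I k <-> len (@is_ideal _) (phi @` A) (phi @` I) k.
    apply: len_image => //; rewrite pk => p hp.
    by apply: (sumsetr (@ideal_modular _) hmI).
  rewrite /is_mu -(image_max_mul ph ps hI); suff -> : phi @` A = phi @` mI by [].
  apply/seteqP; split; last exact: image_subset.
  move=> _ [_ [p [q [hp [_ hq] ->]]] <-]; exists p => //.
  move: hq; rewrite -pk /= => e; by rewrite rmorphD /= e addr0.
split=> [h|[k [q [/e2 hk /e1 hq <-]]]].
  have [q [k [hq hk <-]]] := len_split (@ideal_modular _) hA mA AI h.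
  by exists k, q; split; [exact/e2|exact/e1|rewrite addnC].
by rewrite addnC; exact: (len_add (@ideal_modular _) hq hk).
Qed.

Lemma lrmorphism_ext n m (f g : {lrmorphism {mpoly K[n]} -> {mpoly K[m]}}) :
  (forall i, f 'X_i = g 'X_i) -> f =1 g.
Proof.
move=> h; elim/mpoly_ind => [c|//|p q hp hq|p q hp hq].
- by rewrite !lrmorphC.
- by rewrite !rmorphD /= hp hq.
- by rewrite !rmorphM /= hp hq.
Qed.

Lemma comp_mpoly_homog n m (lq : n.-tuple {mpoly K[m]}) d p :
  (forall i, tnth lq i \is 1.-homog) -> p \is d.-homog -> p \mPo lq \is d.-homog.
Proof.
move=> hl /dhomogP hp; rewrite comp_mpolyEX big_seq; apply: rpred_sum => mon hm.
apply: rpredZ; rewrite comp_mpolyX.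
have <- : (\sum_i mon i)%N = d by rewrite -mdegE; exact: hp.
elim/big_rec2: _ => [|i k q _ hq]; first exact: dhomog1.
by apply: dhomogM hq; have := dhomogMn (mon i) (hl i); rewrite mul1n.
Qed.

(** A variable with nonzero coefficient in the form is solved for and eliminated; [sg] embeds the
    remaining variables back as a section. *)
Lemma quotient_exists n (a : 'rV[K]_n.+1) : a != 0 ->
  exists phi : {lrmorphism {mpoly K[n.+1]} -> {mpoly K[n]}},
    graded_quotient (ideal_gen [set lform a]) phi.
Proof.
move=> a0; have [j aj] : exists j, a 0 j != 0.
  case: (pselect (exists j, a 0 j != 0)) => // h; case/eqP: a0; apply/rowP=> j.
  by rewrite mxE; apply/eqP/negPn/negP => aj; apply: h; exists j.
pose c := (a 0 j)^-1.
pose g (i : 'I_n.+1) : {mpoly K[n]} :=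
  if unlift j i is Some k then 'X_k else - (c *: \sum_k a 0 (lift j k) *: 'X_k).
pose phi : {lrmorphism {mpoly K[n.+1]} -> {mpoly K[n]}} := @comp_mpoly n.+1 K n [tuple g i | i < n.+1].
pose sg : {lrmorphism {mpoly K[n]} -> {mpoly K[n.+1]}} := @comp_mpoly n K n.+1 [tuple 'X_(lift j k) | k < n].
have phiX i : phi 'X_i = g i by rewrite /phi /= comp_mpolyXU -tnth_nth tnth_mktuple.
have sgX k : sg 'X_k = 'X_(lift j k) by rewrite /sg /= comp_mpolyXU -tnth_nth tnth_mktuple.
have gl k : g (lift j k) = 'X_k by rewrite /g liftK.
have gj : g j = - (c *: \sum_k a 0 (lift j k) *: 'X_k) by rewrite /g unlift_none.
have phisg q : phi (sg q) = q.
  apply: (@lrmorphism_ext n n (phi \o sg) idfun) => k /=.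
  by rewrite sgX phiX gl.
have lformD : lform a = a 0 j *: 'X_j + \sum_k a 0 (lift j k) *: 'X_(lift j k).
  by rewrite /lform (bigD1_ord j).
have phiz : phi (lform a) = 0.
  rewrite lformD linearD linearZ linear_sum /= phiX gj scalerN scalerA divff // scale1r.
  under [X in _ + X]eq_bigr => k _ do rewrite linearZ /= phiX gl.
  by rewrite addNr.
have hz := @ideal_gen_ideal _ [set lform a].
(* Modulo the form, [sg] is also a left inverse of [phi]; this determines the kernel. *)
have ker p : ideal_gen [set lform a] (p - sg (phi p)).
  elim/mpoly_ind: p => [b|i|p q hp hq|p q hp hq].
  - by rewrite !lrmorphC subrr; exact: (ideal0 hz).
  - rewrite phiX; case: (unliftP j i) => [k ->|->].
      by rewrite gl sgX subrr; exact: (ideal0 hz).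
    apply/ideal_gen1; exists c%:MP; rewrite mul_mpolyC lformD scalerDr scalerA mulVf // scale1r.
    rewrite gj linearN linearZ linear_sum /= opprK; congr (_ + _ *: _).
    by apply: eq_bigr => k _; rewrite linearZ /= sgX.
  - by rewrite !rmorphD /= opprD addrACA; exact: (idealD hz hp hq).
  - rewrite !rmorphM /=.
    have -> : p * q - sg (phi p) * sg (phi q) =
      (p - sg (phi p)) * q + sg (phi p) * (q - sg (phi q)).
      by rewrite mulrBl mulrBr addrA subrK.
    exact: (idealD hz (idealMr _ hz hp) (idealM _ hz hq)).
exists phi; split.
- by apply/seteqP; split=> // q _; exists (sg q).
- apply/seteqP; split=> [p /= hp|p /ideal_gen1[r ->]].
    by rewrite -[p]subr0 -(rmorph0 sg) -hp.
  by rewrite /= rmorphM /= phiz mulr0.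
- move=> d p; apply: comp_mpoly_homog => i; rewrite tnth_mktuple /g.
  have hX k : ('X_k : {mpoly K[n]}) \is 1.-homog by rewrite -lform_delta; exact: lform_homog.
  case: (unlift j i) => [k|]; first exact: hX.
  by rewrite rpredN; apply: rpredZ; apply: rpred_sum => k _; apply: rpredZ; exact: hX.
Qed.

(** Lifting by one fixed matrix makes the lift of a form linear in its coefficients, so polynomial
    conditions on forms of the source pull back to forms of the quotient. *)
Lemma lift_section n m (phi : {lrmorphism {mpoly K[n]} -> {mpoly K[m]}}) :
  (forall d p, p \is d.-homog -> phi p \is d.-homog) -> range phi = setT ->
  exists S : 'M[K]_(m, n), forall b, phi (lform (b *m S)) = lform b.
Proof.
move=> ph ps.
have /choice[s hs] (k : 'I_m) : exists a, phi (lform a) = 'X_k.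
  by have [a ha] := graded_lift_lform ph (delta_mx 0 k) ps; exists a; rewrite ha lform_delta.
exists (\matrix_k s k) => b.
rewrite mulmx_sum_row (linear_sum (@lform K n)) (linear_sum phi) [in RHS]/lform /=.
by apply: eq_bigr => k _; rewrite rowK !linearZ /= hs.
Qed.

(** The factor is [theta] after a section of [phi]; the choice of section does not matter because L
    is contained in L'. It preserves degrees because a homogeneous element lifts to a homogeneous
    one, a component of any lift. *)
Lemma graded_factor n m k (phi : {lrmorphism {mpoly K[n]} -> {mpoly K[m]}})
    (theta : {lrmorphism {mpoly K[n]} -> {mpoly K[k]}}) (L L' : set {mpoly K[n]}) :
  graded_quotient L phi -> graded_quotient L' theta -> L `<=` L' ->
  exists2 psi : {lrmorphism {mpoly K[m]} -> {mpoly K[k]}},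
    graded_quotient (phi @` L') psi & forall p, psi (phi p) = theta p.
Proof.
move=> [ps pk ph] [ts tk th] LL'.
have [S hS] := lift_section ph ps.
pose sg : {lrmorphism {mpoly K[m]} -> {mpoly K[n]}} := @comp_mpoly m K n [tuple lform (row i S) | i < m].
have phisg q : phi (sg q) = q.
  apply: (@lrmorphism_ext m m (phi \o sg) idfun) => i /=.
  rewrite /sg /= comp_mpolyXU -tnth_nth tnth_mktuple rowE hS.
  exact: lform_delta.
have psiphi p : theta (sg (phi p)) = theta p.
  apply/eqP; rewrite -subr_eq0 -rmorphB /=; apply/eqP.
  have : L (sg (phi p) - p) by rewrite -pk /= rmorphB /= phisg subrr.
  by move/LL'; rewrite -tk.
exists (theta \o sg) => //; split.
- apply/seteqP; split=> // q _; have [p _ <-] : range theta q by rewrite ts.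
  by exists (phi p) => //=; rewrite psiphi.
- apply/seteqP; split=> [q /= h|_ [p hp <-]].
    by exists (sg q); rewrite ?phisg // -tk.
  by rewrite /= psiphi; move: hp; rewrite -tk.
- move=> d q hq /=.
  have [p _ hp] : range phi q by rewrite ps.
  have -> : q = phi (pihomog mdeg d p) by rewrite graded_pihomog // hp pihomog_dE.
  by rewrite psiphi; apply: th; exact: pihomogP.
Qed.

(** The rings of a t-sequence are known only up to a chosen identification. For the last of them
    nothing is divided out, and this lemma removes the identification. *)
Lemma t_value_iso n m (phi : {lrmorphism {mpoly K[n]} -> {mpoly K[m]}})
    (J : set {mpoly K[n]}) t :
  graded_quotient [set 0] phi -> is_ideal J -> is_t_value (phi @` J) t ->
  is_t_value J t.
Proof.
move=> [ps pk ph] hJ [[b hb] tmin].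
have e (a : 'rV[K]_n) b' l : phi (lform a) = lform b' ->
    is_length J (colon J (lform a)) l <-> is_length (phi @` J) (colon (phi @` J) (lform b')) l.
  move=> ab.
  have -> : colon (phi @` J) (lform b') = phi @` colon J (lform a).
    rewrite -ab; apply/seteqP; split=> [q|_ [p hp <-]]; rewrite /colon /=; last first.
      by exists (p * lform a) => //; rewrite rmorphM.
    have [p _ <-] : range phi q by rewrite ps.
    move=> [r hr]; rewrite -rmorphM => e; exists p => //=.
    have : (phi @^-1` [set 0]) (p * lform a - r) by rewrite /= rmorphB /= e subrr.
    by rewrite pk /= => /eqP; rewrite subr_eq0 => /eqP->.
  apply: len_image => //; [exact: colon_ideal|exact: sub_colon|].
  by rewrite pk => p [_ ->]; exact: ideal0.
split.
  have [a ab] := graded_lift_lform ph b ps.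
  by exists a; apply/(e _ _ _ ab).
move=> a l; have [b' ab] := graded_lform ph a.
by move/(e _ _ _ ab); exact: tmin.
Qed.

End Quotients.

(** * General position *)

Section Generic.
Variable K : fieldType.

Definition polyfun (r n : nat) (g : 'M[K]_(r, n) -> K) : Prop :=
  exists f : {mpoly K[r * n]}, forall Z, f.@[fun k => mxvec Z 0 k] = g Z.

Section Closure.
Variables (r n : nat).
Implicit Types (g h : 'M[K]_(r, n) -> K).

Lemma polyfun_const c : polyfun (fun _ : 'M[K]_(r, n) => c).
Proof. by exists c%:MP => Z; rewrite mevalC. Qed.

Lemma polyfun_coord i j : polyfun (fun Z : 'M[K]_(r, n) => Z i j).
Proof. by exists 'X_(mxvec_index i j) => Z; rewrite mevalXU mxvecE. Qed.

Lemma polyfunD g h : polyfun g -> polyfun h -> polyfun (fun Z => g Z + h Z).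
Proof. by move=> [f hf] [e he]; exists (f + e) => Z; rewrite mevalD hf he. Qed.

Lemma polyfunM g h : polyfun g -> polyfun h -> polyfun (fun Z => g Z * h Z).
Proof. by move=> [f hf] [e he]; exists (f * e) => Z; rewrite mevalM hf he. Qed.

Lemma polyfun_sum (T : Type) (s : seq T) (P : pred T) (F : T -> 'M[K]_(r, n) -> K) :
  (forall i, polyfun (F i)) -> polyfun (fun Z => \sum_(i <- s | P i) F i Z).
Proof.
move=> hF; elim: s => [|x s [f hf]].
  by exists 0 => Z; rewrite meval0 big_nil.
have [e he] := hF x; exists (if P x then e + f else f) => Z; rewrite big_cons.
by case: (P x) => //; rewrite mevalD he hf.
Qed.

Lemma polyfun_prod (T : Type) (s : seq T) (P : pred T) (F : T -> 'M[K]_(r, n) -> K) :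
  (forall i, polyfun (F i)) -> polyfun (fun Z => \prod_(i <- s | P i) F i Z).
Proof.
move=> hF; elim: s => [|x s [f hf]].
  by exists 1 => Z; rewrite meval1 big_nil.
have [e he] := hF x; exists (if P x then e * f else f) => Z; rewrite big_cons.
by case: (P x) => //; rewrite mevalM he hf.
Qed.

Lemma polyfun_det k (A : 'M[K]_(r, n) -> 'M[K]_k) :
  (forall i j, polyfun (fun Z => A Z i j)) -> polyfun (fun Z => \det (A Z)).
Proof.
move=> hA; apply: polyfun_sum => s; apply: polyfunM; first exact: polyfun_const.
by apply: polyfun_prod => i; exact: hA.
Qed.

End Closure.

Lemma polyfun_comp r n r' n' (g : 'M[K]_(r, n) -> K) (A : 'M[K]_(r', n') -> 'M[K]_(r, n)) :
  polyfun g -> (forall i j, polyfun (fun Z => A Z i j)) -> polyfun (g \o A).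
Proof.
move=> [f hf] hA.
have /choice[h hh] (k : 'I_(r * n)) : exists h : {mpoly K[r' * n']},
    forall Z, h.@[fun k => mxvec Z 0 k] = mxvec (A Z) 0 k.
  by case/mxvec_indexP: k => i j; have [h hh] := hA i j; exists h => Z; rewrite hh mxvecE.
exists (f \mPo [tuple h k | k < r * n]) => Z.
rewrite comp_mpoly_meval /= -hf; apply: meval_eq => k.
by rewrite tnth_mktuple hh.
Qed.

(** Restriction to a line turns nonvanishing into a question about roots of a polynomial in one
    variable. *)
Lemma polyfun_line r n (g : 'M[K]_(r, n) -> K) (Z0 Z1 : 'M[K]_(r, n)) :
  polyfun g -> exists F : {poly K}, forall s, F.[s] = g (Z0 + s *: Z1).
Proof.
move=> [f hf]; suff [F hF] : exists F : {poly K}, forall s,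
    F.[s] = f.@[fun k => mxvec (Z0 + s *: Z1) 0 k] by exists F => s; rewrite hF hf.
elim/mpoly_ind: {hf} f => [c|i|p q [F hF] [G hG]|p q [F hF] [G hG]].
- by exists c%:P => s; rewrite hornerC mevalC.
- exists ((mxvec Z0 0 i)%:P + (mxvec Z1 0 i) *: 'X) => s.
  by rewrite mevalXU hornerD hornerC hornerZ hornerX linearD linearZ /= !mxE mulrC.
- by exists (F + G) => s; rewrite hornerD mevalD hF hG.
- by exists (F * G) => s; rewrite hornerM mevalM hF hG.
Qed.

(** A nonempty open set contains a principal one, so a single polynomial function can witness
    genericity. *)
Lemma genericP r n (P : 'M[K]_(r, n) -> Prop) : generic P <->
  exists g, [/\ polyfun g, exists Z, g Z != 0 & forall Z, g Z != 0 -> P Z].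
Proof.
split=> [[U [[F ->] [Z [f Ff fZ]] h]]|[g [[f hf] [Z0 gZ0] h]]].
  exists (fun Z => f.@[fun k => mxvec Z 0 k]); split; [by exists f|by exists Z|].
  by move=> Z' fZ'; apply: h; exists f.
exists [set Z | g Z != 0]; split=> //; last by exists Z0.
exists [set f]; apply/seteqP; split=> Z /=; first by move=> gZ; exists f; rewrite ?hf.
by move=> [_ -> ]; rewrite hf.
Qed.

Lemma generic_ex r n (P : 'M[K]_(r, n) -> Prop) : generic P -> exists Z, P Z.
Proof. by case/genericP=> g [_ [Z gZ] h]; exists Z; exact: h. Qed.

Lemma generic_imp r n (P Q : 'M[K]_(r, n) -> Prop) :
  (forall Z, P Z -> Q Z) -> generic P -> generic Q.
Proof. by move=> PQ [U [zU U0 UP]]; exists U; split=> // Z /UP /PQ. Qed.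

Hypothesis hK : infinite_set [set: K].

Lemma infinite_nonroot (F : {poly K}) : F != 0 -> exists s, F.[s] != 0.
Proof.
move=> F0.
have hs k : exists s : seq K, uniq s /\ size s = k.
  elim: k => [|k [s [us sk]]]; first by exists [::].
  suff [x xs] : exists x, x \notin s by exists (x :: s); rewrite /= xs us sk.
  apply: contrapT => h; apply: hK; apply: (@sub_finite_set _ _ [set` s]) => [x _ /=|].
    by apply/negPn/negP => xs; apply: h; exists x.
  exact: finite_seq.
have [s [us ss]] := hs (size F).
apply: contrapT => h; suff rs : all (root F) s by have := max_poly_roots F0 rs us; rewrite ss ltnn.
apply/allP => x _; apply/negPn/negP => xF; apply: h; exists x; exact: xF.
Qed.

(** On the line from Z0 to Z1, g is nonzero at parameter 0 and h at parameter 1. Both restrictions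
    are thus nonzero polynomials, and over an infinite field some parameter is a root of neither. *)
Lemma generic_and r n (P Q : 'M[K]_(r, n) -> Prop) :
  generic P -> generic Q -> generic (fun Z => P Z /\ Q Z).
Proof.
move=> /genericP[g [pg [Z0 gZ0] hP]] /genericP[h [ph [Z1 hZ1] hQ]].
apply/genericP; exists (fun Z => g Z * h Z); split; first exact: polyfunM.
  have [F hF] := polyfun_line Z0 (Z1 - Z0) pg.
  have [G hG] := polyfun_line Z0 (Z1 - Z0) ph.
  have F0 : F != 0 by apply: contraNneq gZ0 => F0; have := hF 0; rewrite F0 horner0 scale0r addr0 => <-.
  have G0 : G != 0.
    apply: contraNneq hZ1 => G0; have := hG 1; rewrite G0 horner0 scale1r addrC subrK.
    by move=> <-.
  have [s] := infinite_nonroot (mulf_neq0 F0 G0).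
  by rewrite hornerM hF hG => hs; exists (Z0 + s *: (Z1 - Z0)).
by move=> Z; rewrite mulf_eq0 negb_or => /andP[/hP ? /hQ ?].
Qed.

End Generic.

(** * Noetherianity and associated primes *)

(** [h a] is an index from a onwards at which f is least; iterating past each chosen index gives the
    subsequence. *)
Lemma nondecreasing_subseq (f : nat -> nat) : exists2 g : nat -> nat,
  {homo g : i j / (i < j)%N} & {homo f \o g : i j / (i <= j)%N}.
Proof.
have /choice[h hP] a : exists b, (a <= b)%N /\ forall c, (a <= c)%N -> (f b <= f c)%N.
  have ex : exists v, `[< exists2 b, (a <= b)%N & f b = v >].
    by exists (f a); apply/asboolP; exists a.
  case: (ex_minnP ex) => v /asboolP[b ab <-] hv; exists b; split=> // c ac.
  by apply: hv; apply/asboolP; exists c.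
pose g k := iter k (fun x => h x.+1) (h 0%N).
have gS k : (g k < g k.+1)%N by exact: (hP (g k).+1).1.
have gmin k c : (g k <= c)%N -> (f (g k) <= f c)%N.
  case: k => [_|k hc]; first exact: (hP 0%N).2.
  by apply: (hP (g k).+1).2; exact: leq_trans (gS k) hc.
exists g; first by apply: homo_ltn gS; exact: ltn_trans.
by apply: homo_leq => [//|y x z|k]; [exact: leq_trans|apply: gmin; exact: ltnW].
Qed.

(** Subsequences are refined one coordinate at a time; after all n coordinates any two terms are
    comparable. *)
Lemma dickson n (m : nat -> 'X_{1..n}) :
  exists i j, (i < j)%N /\ (m i <= m j)%MM.
Proof.
suff /(_ n (leqnn n))[g gi gm] : forall k, (k <= n)%N ->
    exists2 g : nat -> nat, {homo g : i j / (i < j)%N} &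
    forall i : 'I_n, (i < k)%N -> {homo (fun k => m (g k) i) : a b / (a <= b)%N}.
  exists (g 0%N), (g 1%N); split; first exact: gi.
  by apply/mnm_lepP => i; apply: gm.
elim=> [|k IH] kn; first by exists id.
have [g gi gm] := IH (ltnW kn).
have [h hi hm] := nondecreasing_subseq (fun a => m (g a) (Ordinal kn)).
exists (g \o h) => [a b ab|i]; first by apply: gi; exact: hi.
rewrite ltnS leq_eqVlt => /orP[/eqP ik|ik] a b ab /=.
  have -> : i = Ordinal kn by apply: val_inj.
  exact: hm.
by apply: gm => //; apply: (homo_leq (r := leq)) ab => // [y x z|c]; [exact: leq_trans|apply: ltnW; exact: hi].
Qed.

(** Course-of-values recursion: each term is chosen in view of the list of all earlier terms. *)
Lemma greedy_seq (T : Type) (c : seq T -> T) :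
  exists y : nat -> T, forall k, y k = c (mkseq y k).
Proof.
pose ys k := iter k (fun s => rcons s (c s)) [::].
exists (fun k => c (ys k)) => k; congr c.
by elim: k => // k IH; rewrite mkseqS -IH.
Qed.

Section Noetherian.
Variables (K : fieldType) (n : nat).
Local Notation R := {mpoly K[n]}.
Implicit Types (J : set R) (p q : R).

Lemma min_mlead J : J !=set0 ->
  exists2 p, J p & forall q, J q -> ~ (mlead q < mlead p)%O.
Proof.
case=> p hp; apply: contrapT => h.
suff : forall m q, mlead q = m -> ~ J q by move=> /(_ _ p erefl).
move=> m; elim/(@ltmwf n): m => m IH q qm hq; apply: h; exists q => // r hr; rewrite qm => rm.
exact: (IH _ rm r).
Qed.

Lemma mlead_reduce p q : p != 0 -> q != 0 -> (mlead q <= mlead p)%MM ->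
  exists r, let s := p - r * q in s = 0 \/ (mlead s < mlead p)%O.
Proof.
move=> p0 q0 qp; pose m := (mlead p - mlead q)%MM.
pose c := p@_(mlead p) / q@_(mlead q).
exists (c *: 'X_[m]) => /=; set s := p - _.
case: (eqVneq s 0) => [|s0]; [by left|right].
have s_lead : s@_(mlead p) = 0.
  rewrite /s -scalerAl mcoeffB mcoeffZ [_ * q]mulrC.
  rewrite -{2}(submK qp) mcoeffMX /c divfK ?subrr //.
  by rewrite mleadc_eq0.
rewrite lt_neqAle; apply/andP; split.
  by apply: contraNneq s0 => e; rewrite -mleadc_eq0 e s_lead.
apply: le_trans (mleadB_le _ _) _; rewrite leUx lexx /=.
rewrite -scalerAl; apply: le_trans (mleadZ_le _ _) _.
apply: le_trans (mleadM_le _ _) _.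
by rewrite mleadXm /m submK // lexx.
Qed.

(* Greedily adding an element of J of minimal leading monomial outside the ideal
   generated so far must stop: by Dickson's lemma some leading monomial would
   divide a later one, and reduction would contradict minimality. *)
Lemma ideal_fin_gen J : is_ideal J ->
  exists2 s : seq R, [set` s] `<=` J & J `<=` ideal_gen [set` s].
Proof.
move=> hJ; apply: contrapT => h.
have /choice[c hc] (s : seq R) : exists p, [set` s] `<=` J ->
    [/\ J p, ~ ideal_gen [set` s] p &
      forall q, J q -> ~ ideal_gen [set` s] q -> ~ (mlead q < mlead p)%O].
  case: (pselect ([set` s] `<=` J)) => [sJ|]; last by exists 0.
  have [|p [Jp np] pm] := @min_mlead (J `\` ideal_gen [set` s]).
    apply: contrapT => e; apply: h; exists s => // p Jp.
    by apply: contrapT => np; apply: e; exists p.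
  by exists p => _; split=> // q Jq nq; exact: pm.
have [y yE] := greedy_seq c.
have sub k : [set` mkseq y k] `<=` J.
  elim: k => [|k IH] p; first by [].
  rewrite mkseqS /= mem_rcons inE => /orP[/eqP->|]; last exact: IH.
  by rewrite yE; have [] := hc _ IH.
have yP k : [/\ J (y k), ~ ideal_gen [set` mkseq y k] (y k) &
      forall q, J q -> ~ ideal_gen [set` mkseq y k] q -> ~ (mlead q < mlead (y k))%O].
  by rewrite [in y k]yE; exact: hc.
have y0 k : y k != 0.
  apply/eqP => y0; have [_ + _] := yP k; rewrite y0; apply.
  exact: ideal0 (@ideal_gen_ideal _ _).
have [i [j [ij le]]] := dickson (fun k => mlead (y k)).
have [r] := mlead_reduce (y0 j) (y0 i) le; set s := _ - _ => /= hs.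
have [Jj nj jmin] := yP j; have [Ji _ _] := yP i.
have hI := @ideal_gen_ideal _ [set` mkseq y j].
have yij : ideal_gen [set` mkseq y j] (r * y i).
  apply: (idealM _ hI); apply: sub_ideal_gen => /=.
  by apply/mapP; exists i => //; rewrite mem_iota.
have ns : ~ ideal_gen [set` mkseq y j] s.
  by move=> hs'; apply: nj; rewrite -(subrK (r * y i) (y j)); exact: (idealD hI).
case: hs => [s0|]; first by apply: ns; rewrite s0; exact: ideal0.
apply: jmin => //; apply: idealB => //; exact: idealM.
Qed.

(** The union of the ideals generated by initial segments is finitely generated, so it is already
    reached at some stage k, and x k lies in that stage. *)
Lemma noetherian_seq (x : nat -> R) :
  exists k, ideal_gen [set x i | i in [set i | (i < k)%N]] (x k).
Proof.
apply: contrapT => h.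
pose I k := ideal_gen [set x i | i in [set i | (i < k)%N]].
have hI k : is_ideal (I k) by exact: ideal_gen_ideal.
have mono i j : (i <= j)%N -> I i `<=` I j.
  move=> ij; apply: ideal_genS => _ [k ki <-]; exists k => //; exact: leq_trans ki ij.
have hU : is_ideal [set p | exists k, I k p].
  split=> [|p q [k hk] [l hl]|p q [k hk]].
  - by exists 0%N; exact: ideal0.
  - exists (maxn k l); apply: (idealD (hI _)).
      by apply: mono hk; exact: leq_maxl.
    by apply: mono hl; exact: leq_maxr.
  - by exists k; apply: (idealM _ (hI _)).
have [s sU Us] := ideal_fin_gen hU.
have [k hk] : exists k, [set` s] `<=` I k.
  elim: s sU {Us} => [|p s IH] sU; first by exists 0%N.
  have [|k hk] := IH; first by move=> q qs; apply: sU; rewrite /= inE qs orbT.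
  have [l hl] : exists l, I l p by apply: sU; rewrite /= inE eqxx.
  exists (maxn k l) => q; rewrite /= inE => /orP[/eqP->|/hk].
    by apply: mono hl; exact: leq_maxr.
  by apply: mono; exact: leq_maxl.
apply: h; exists k; apply: (ideal_gen_sub (hI k) hk); apply: Us; exists k.+1.
by apply: sub_ideal_gen; exists k => /=.
Qed.

Lemma ideal_acc (J : nat -> set R) : (forall k, is_ideal (J k)) ->
  (forall k, J k `<=` J k.+1) -> exists k, J k = J k.+1.
Proof.
move=> hJ mono; apply: contrapT => h.
have /choice[x hx] k : exists x, J k.+1 x /\ ~ J k x.
  apply: contrapT => e; apply: h; exists k; apply/seteqP; split=> // p hp.
  by apply: contrapT => np; apply: e; exists p.
have [k hk] := noetherian_seq x; apply: (hx k).2.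
apply: (ideal_gen_sub (hJ k)) hk => _ [i ik <-].
have ik' : (i.+1 <= k <= k)%N by rewrite leqnn andbT.
exact: (nested (fun i _ => mono i) ik' (hx i).1).
Qed.

(** * Maximal annihilators in R/N and general nonzerodivisors *)

Section Associated.
Variables (N : set R) (hN : is_ideal N).

(** [colon N x] is the annihilator of the class of x in R/N. The maximal annihilators of nonzero
    classes are associated primes, and their union is the set of zero divisors on R/N. *)
Definition max_annihilator (x : R) := ~ N x /\
  forall y, ~ N y -> colon N x `<=` colon N y -> colon N y `<=` colon N x.

(** Otherwise annihilators above that of x could be enlarged forever, against the ascending chain
    condition. *)
Lemma ex_max_annihilator x : ~ N x ->
  exists2 y, max_annihilator y & colon N x `<=` colon N y.
Proof.
move=> nx; apply: contrapT => h.
pose above y := ~ N y /\ colon N x `<=` colon N y.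
have /choice[c hc] y : exists z, above y -> [/\ above z, colon N y `<=` colon N z &
    ~ (colon N z `<=` colon N y)].
  case: (pselect (above y)) => [ay|]; last by exists 0.
  apply: contrapT => e; apply: h; exists y; last exact: ay.2.
  split=> [|z nz yz]; first exact: ay.1.
  apply: contrapT => zy; apply: e; exists z => _; split=> //; split=> //.
  exact: subset_trans ay.2 yz.
pose y k := iter k c x.
have ya k : above (y k) by elim: k => [|k IH]; [split|have [] := hc _ IH].
have [k hk] := @ideal_acc (fun k => colon N (y k)) (fun k => colon_ideal _ hN)
  (fun k => let: And3 _ h _ := hc _ (ya k) in h).
have [_ _] := hc _ (ya k); rewrite -[c (y k)]/(y k.+1) -hk; exact.
Qed.

(** If qx is not in N, its annihilator contains that of x, hence equals it by maximality, and p lies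
    in it. *)
Lemma max_annihilator_prime x p q : max_annihilator x ->
  N (p * q * x) -> N (p * x) \/ N (q * x).
Proof.
move=> [nx xm] h; case: (pselect (N (q * x))) => [|nq]; [by right|left].
apply: (xm (q * x)) => //; last by rewrite /colon /= mulrA.
move=> r; rewrite /colon /= => hr.
by rewrite mulrA mulrAC; exact: idealMr.
Qed.

(* In an infinite sequence y of elements with distinct maximal annihilators, some
   y_k lies in the ideal of the y_i, i < k, so ann(y_k) contains the product of
   the ann(y_i); being prime it contains one of them, hence equals it. *)
Lemma fin_max_annihilator : exists2 s : seq R,
  (forall x, x \in s -> max_annihilator x) &
  forall x, max_annihilator x -> exists2 y, y \in s & colon N x = colon N y.
Proof.
apply: contrapT => h.
have /choice[c hc] (s : seq R) : exists x, (forall y, y \in s -> max_annihilator y) ->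
    max_annihilator x /\ forall y, y \in s -> colon N x <> colon N y.
  case: (pselect (forall y, y \in s -> max_annihilator y)) => [hs|]; last by exists 0.
  apply: contrapT => e; apply: h; exists s => // x hx.
  apply: contrapT => nx; apply: e; exists x => _; split=> // y ys xy.
  by apply: nx; exists y.
have [y yE] := greedy_seq c.
have all_max k : forall z, z \in mkseq y k -> max_annihilator z.
  elim: k => [|k IH] z; first by [].
  rewrite mkseqS mem_rcons inE => /orP[/eqP->|]; last exact: IH.
  by rewrite yE; have [] := hc _ IH.
have ym k : max_annihilator (y k) by rewrite yE; have [] := hc _ (all_max k).
have yd i k : (i < k)%N -> colon N (y k) <> colon N (y i).
  move=> ik; rewrite [y k]yE; apply: (hc _ (all_max k)).2.
  by apply/mapP; exists i => //; rewrite mem_iota.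
have [k hk] := noetherian_seq y.
suff [i ik sub] : exists2 i, (i < k)%N & colon N (y i) `<=` colon N (y k).
  apply: (yd _ _ ik); apply/seteqP; split=> //.
  by apply: (ym i).2 => //; exact: (ym k).1.
apply: contrapT => e.
have /choice[r hr] i : exists r, (i < k)%N -> N (r * y i) /\ ~ N (r * y k).
  case: (ltnP i k) => ik; last by exists 0.
  apply: contrapT => e'; apply: e; exists i => // p hp.
  by apply: contrapT => np; apply: e'; exists p.
pose P := \prod_(i < k) r i.
have Pk : N (P * y k).
  rewrite mulrC; apply: (ideal_gen_sub (colon_ideal P hN)) hk => _ [i ik <-].
  rewrite /colon /= /P (bigD1 (Ordinal ik)) //= mulrA; apply: idealMr => //.
  by rewrite mulrC; exact: (hr i ik).1.
have : ~ N (P * y k).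
  rewrite /P; elim/big_rec: _ => [|i x _ IH]; first by rewrite mul1r; exact: (ym k).1.
  by case/(max_annihilator_prime (ym k)) => //; exact: (hr i (ltn_ord i)).2.
exact.
Qed.

End Associated.

(** A matrix of maximal rank with rows in V has row space V, since a further vector of V would raise
    the rank. Its cokernel matrix vanishes exactly on V, so one of its columns is a linear
    functional that is nonzero at a0. *)
Lemma avoid_subspace (V : set 'rV[K]_n) a0 : subsp V -> ~ V a0 ->
  exists2 g : 'rV[K]_n -> K, polyfun g & g a0 != 0 /\ forall a, V a -> g a = 0.
Proof.
move=> hV na0.
have ex : exists r, `[< exists2 B : 'M[K]_n, \rank B = r & forall i, V (row i B) >].
  exists 0%N; apply/asboolP; exists 0; first exact: mxrank0.
  by move=> i; rewrite row0; case: hV.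
have ub r : `[< exists2 B : 'M[K]_n, \rank B = r & forall i, V (row i B) >] -> (r <= n)%N.
  by move/asboolP => [B <- _]; exact: rank_leq_row.
case: (ex_maxnP ex ub) => r /asboolP[B Br hB] rmax.
have subV m (C : 'M[K]_(m, n)) : (forall i, V (row i C)) -> forall a : 'rV_n, (a <= C)%MS -> V a.
  move=> hC a /submxP[D ->]; rewrite mulmx_sum_row; apply: subsp_sum => // i _.
  by case: hV => _ _; apply.
have VB a : V a -> (a <= B)%MS.
  move=> Va; apply: contrapT => /negP aB.
  have : (\rank (B + a)%MS <= r)%N.
    apply: rmax; apply/asboolP; exists (B + a)%MS => // i.
    apply: (subV _ (col_mx B a)); last by rewrite (submx_trans (row_sub _ _)) // addsmxE.
    move=> j; case: (split_ordP j) => k ->; rewrite ?rowKu ?rowKd //.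
    by rewrite (_ : row k a = a) //; apply/rowP=> l; rewrite !mxE ord1.
  rewrite -Br leqNgt; case/negP; rewrite ltnNge; apply: contra aB => le.
  have := mxrank_leqif_sup (addsmxSl B a) => -[_].
  rewrite eqn_leq le mxrankS ?addsmxSl //= => /esym sup.
  by apply: submx_trans sup; exact: addsmxSr.
have [j gj] : exists j, (a0 *m cokermx B) 0 j != 0.
  apply: contrapT => h; apply: na0; apply: (subV _ B) => //.
  rewrite submxE; apply/eqP/rowP=> j; rewrite [RHS]mxE; apply/eqP/negPn/negP => hj.
  by apply: h; exists j.
exists (fun a => (a *m cokermx B) 0 j).
  have -> : (fun a : 'rV[K]_n => (a *m cokermx B) 0 j) =
      fun a => \sum_k a 0 k * cokermx B k j by apply/funext=> a; rewrite mxE.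
  apply: polyfun_sum => k; apply: polyfunM; [exact: polyfun_coord|exact: polyfun_const].
by split=> // a /VB; rewrite submxE => /eqP->; rewrite mxE.
Qed.

(** The linear forms in a maximal annihilator form a subspace that misses a0. The product, over the
    finitely many such annihilators, of functionals vanishing on these subspaces defines the open
    set: a form that is a zero divisor would lie in one of them. *)
Lemma nonzerodivisor_generic (N : set R) (a0 : 'rV[K]_n) : is_ideal N ->
  colon N (lform a0) = N -> generic (fun a : 'rV[K]_n => colon N (lform a) = N).
Proof.
move=> hN nzd; apply/genericP.
have [s smax sall] := fin_max_annihilator hN.
have /choice[G hG] (x : R) : exists g : 'rV[K]_n -> K, [/\ polyfun g,
    max_annihilator N x -> g a0 != 0 & max_annihilator N x ->
      forall a, N (lform a * x) -> g a = 0].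
  case: (pselect (max_annihilator N x)) => [mx|]; last first.
    (* A default value: only representatives of maximal annihilators enter the product. *)
    by exists (fun=> 0); split=> //; exact: polyfun_const.
  have [||g pg [g0 ga]] := @avoid_subspace [set a | N (lform a * x)] a0; last by exists g.
    split=> [|a b /= ha hb|c a /= ha].
    - by rewrite /= raddf0 mul0r; exact: ideal0.
    - by rewrite raddfD mulrDl; exact: idealD.
    - by rewrite linearZ /= -scalerAl -mul_mpolyC; exact: idealM.
  by move=> /= h; apply: mx.1; rewrite -nzd /colon /= mulrC.
exists (fun a => \prod_(x <- s) G x a); split.
- by apply: polyfun_prod => x; have [] := hG x.
- exists a0; rewrite prodf_seq_neq0; apply/allP => x xs /=; have [_ + _] := hG x.
  by apply; exact: smax.
- move=> a; rewrite prodf_seq_neq0 => /allP ha; apply/seteqP; split; last exact: sub_colon.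
  move=> p hp; apply: contrapT => np.
  have [x mx px] := ex_max_annihilator hN np.
  have [y ys xy] := sall x mx.
  have := ha y ys => /=; have [_ _ ->] := hG y; rewrite ?eqxx //; first exact: smax.
  have : colon N y (lform a) by rewrite -xy; apply: px; rewrite /colon /= mulrC.
  by [].
Qed.

End Noetherian.

(** * Length as dimension, and genericity of the t-value *)

(** The first step of a chain of maximal length has length exactly 1, since a longer refinement
    would exceed the maximum. *)
Lemma len_peel (T : zmodType) (C : set T -> Prop) (N M : set T) l :
  modular_class C -> len C N M l.+1 ->
  exists J, [/\ len C N J 1, len C J M l & N `<` J].
Proof.
move=> hC h; have [[J [J0 Jl JC JS]] hmax] := h.
have [cN cM] := lenC h.
have c1 : chain C N (J 1%N) 1.
  by apply: chain1; [|exact: JC|rewrite -J0; exact: JS].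
have cl : chain C (J 1%N) M l.
  exists (fun i => J i.+1); split=> // k hk; [exact: JC|exact: JS].
have [a [b [ha hb ab]]] := len_split hC (JC 1%N isT) (chain_sub c1) (chain_sub cl) h.
have a1 := ha.2 _ c1; have bl := hb.2 _ cl.
have [ea eb] : a = 1%N /\ b = l.
  suff : (a <= 1)%N.
    move=> a1'; have ea : a = 1%N by apply/eqP; rewrite eqn_leq a1 a1'.
    by split=> //; move: ab; rewrite ea add1n => -[].
  by rewrite -(leq_add2r b) ab add1n ltnS.
rewrite ea in ha; rewrite eb in hb; exists (J 1%N); split=> //.
by rewrite -J0; exact: JS.
Qed.

Section Bases.
Variables (K : fieldType) (V : lmodType K).
Implicit Types (N M J : set V).

Definition lcomb h (c : 'rV[K]_h) (e : 'I_h -> V) : V := \sum_i c 0 i *: e i.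

Definition basis_mod N M h (e : 'I_h -> V) : Prop :=
  [/\ forall i, M (e i), forall p, M p -> exists c, N (p - lcomb c e)
    & forall c, N (lcomb c e) -> c = 0].

Lemma lcomb_mul l h (c : 'rV[K]_l) (F : 'M[K]_(l, h)) (e : 'I_h -> V) :
  lcomb (c *m F) e = lcomb c (fun k => lcomb (row k F) e).
Proof.
rewrite /lcomb; under eq_bigr => i _ do rewrite mxE scaler_suml.
rewrite exchange_big /=; apply: eq_bigr => k _; rewrite scaler_sumr.
by apply: eq_bigr => i _; rewrite mxE scalerA.
Qed.

Lemma subspB N p q : subsp N -> N p -> N q -> N (p - q).
Proof. by case: (@subsp_modular _ V) => _ h _ _; apply: h. Qed.

(** Peel off a first step N < J of length 1, spanned modulo N by any v in J outside N, and add v to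
    a basis of M modulo J. *)
Lemma len_basis N M h : len (@subsp K V) N M h -> exists e : 'I_h -> V, basis_mod N M e.
Proof.
elim: h N => [|h IH] N hl.
  have NM := len0 hl; exists (fun=> 0); split=> [[]//|p|c _]; last by apply/rowP=> -[].
  by rewrite -NM => hp; exists 0; rewrite /lcomb big_ord0 subr0.
have [J [hNJ hJM [NJ nJN]]] := len_peel (@subsp_modular _ _) hl.
have [e [eM eG eI]] := IH _ hJM.
have [hN hJ] := lenC hNJ; have JM := len_sub hJM.
have [v Jv Nv] : exists2 v, J v & ~ N v.
  apply: contrapT => h'; apply: nJN => p Jp; apply: contrapT => Np; apply: h'.
  by exists p.
have hv : subsp (sumset N [set p | exists c, p = c *: v]).
  case: (@subsp_modular _ V) => _ _ _; apply=> //; split.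
  - by exists 0; rewrite scale0r.
  - by move=> _ _ [c ->] [d ->]; exists (c + d); rewrite scalerDl.
  - by move=> d _ [c ->]; exists (d * c); rewrite scalerA.
have NS : N `<=` sumset N [set p | exists c, p = c *: v].
  by move=> p hp; exists p, 0; split=> //; [exists 0; rewrite scale0r|rewrite addr0].
have SJ : sumset N [set p | exists c, p = c *: v] `<=` J.
  by apply: (sumset_sub (@subsp_modular _ _)) => // _ [c ->]; case: hJ => _ _; apply.
(* If N + Kv were smaller than J, it would refine the step from N to J to a chain of length 2. *)
have JE p : J p -> exists c, N (p - c *: v).
  move=> Jp; apply: contrapT => h'.
  have c2 : chain (@subsp K V) N J 2.
    apply: (@chain_cat _ _ _ (sumset N [set p | exists c, p = c *: v]) _ 1 1).
      apply: chain1 => //; split=> //; move/(_ v) => H; apply: Nv; apply: H.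
      by exists 0, v; split; [case: hN|exists 1; rewrite scale1r|rewrite add0r].
    apply: chain1 => //; split=> //; move/(_ _ Jp) => [n [_ [hn [c ->] pE]]].
    by apply: h'; exists c; rewrite pE addrK.
  by have := hNJ.2 _ c2.
pose e' (i : 'I_h.+1) := if unlift ord0 i is Some k then e k else v.
have cE (c : 'rV_h.+1) : lcomb c e' = c 0 ord0 *: v + lcomb (\row_k c 0 (lift ord0 k)) e.
  rewrite /lcomb big_ord_recl /e' unlift_none; congr (_ + _).
  by apply: eq_bigr => k _; rewrite liftK mxE.
exists e'; split.
- by move=> i; rewrite /e'; case: (unlift _ _) => [k|]; [exact: eM|exact: JM].
- move=> p /eG[c /JE[d hd]].
  exists (\row_i if unlift ord0 i is Some k then c 0 k else d).
  rewrite cE mxE unlift_none opprD addrCA addrC.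
  have -> : \row_k (\row_i if unlift ord0 i is Some k then c 0 k else d) 0 (lift ord0 k) = c.
    by apply/rowP=> k; rewrite !mxE liftK.
  by [].
- move=> c; rewrite cE => hc.
  have c0 : \row_k c 0 (lift ord0 k) = 0.
    apply: eI; rewrite -[lcomb _ _](addKr (c 0 ord0 *: v)) addrC.
    by apply: subspB => //; [exact: NJ|case: hJ => _ _; apply].
  move: hc; rewrite c0 /lcomb big1 => [|i _]; last by rewrite mxE scale0r.
  rewrite addr0 => hc.
  have c00 : c 0 ord0 = 0.
    apply/eqP/negPn/negP => cn; apply: Nv; rewrite -[v]scale1r -(mulVf cn) -scalerA.
    by case: hN => _ _; apply.
  apply/rowP=> i; rewrite [RHS]mxE; case: (unliftP ord0 i) => [k ->|-> //].
  by move/rowP: c0 => /(_ k); rewrite !mxE.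
Qed.

Lemma independent_le N M h l (f : 'I_l -> V) : len (@subsp K V) N M h ->
  (forall i, M (f i)) -> (forall c, N (lcomb c f) -> c = 0) -> (l <= h)%N.
Proof.
move=> hl fM fI; have [e [eM eG eI]] := len_basis hl; have [hN hM] := lenC hl.
have /choice[F hF] k : exists c, N (f k - lcomb c e) by exact: eG.
pose A := \matrix_k F k.
suff : row_free A by rewrite /row_free => /eqP <-; exact: rank_leq_col.
apply: inj_row_free => c cA; apply: fI.
have : lcomb (c *m A) e = 0 by rewrite cA /lcomb big1 // => i _; rewrite mxE scale0r.
rewrite lcomb_mul => e0; rewrite -[lcomb c f]subr0 -e0 /lcomb -sumrB.
apply: subsp_sum => // i _; rewrite -scalerBr rowK.
by case: hN => _ _; apply; exact: hF.
Qed.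

End Bases.

(** * Length over R equals dimension over K in the graded case *)

Section GradedLength.
Variables (K : fieldType) (n : nat).
Local Notation R := {mpoly K[n]}.
Implicit Types (I M N : set R).

(** This is the power m^d, described by coefficients. *)
Definition order_ge d (p : R) := forall m, (mdeg m < d)%N -> p@_m = 0.

Lemma order_ge_ideal d : is_ideal (order_ge d).
Proof.
split=> [m _|p q hp hq m hm|a p hp m hm]; first exact: mcoeff0.
  by rewrite mcoeffD hp // hq // addr0.
rewrite mcoeffM big1 // => -[k1 k2] /= /eqP mE; rewrite (hp k2) ?mulr0 //.
apply: leq_ltn_trans hm; have /esym := congr1 mdeg mE; rewrite mdegD => e.
exact: leq_trans (leq_addl _ _) (eq_leq e).
Qed.

Lemma order_ge_homog d (p : R) : p \is d.-homog -> order_ge d p.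
Proof.
move=> hp m md; rewrite (dhomog_nemf_coeff hp) //.
by apply: contraTneq md => <-; rewrite ltnn.
Qed.

Lemma mcoeff_pihomog d (p : R) m :
  (pihomog mdeg d p)@_m = if mdeg m == d then p@_m else 0.
Proof.
case: ifP => [/eqP <-|/negbT h]; last by rewrite (dhomog_nemf_coeff (pihomogP mdeg d p)).
pose k := maxn (msize p) (mdeg m).+1.
have pk : (msize p <= k)%N by rewrite leq_maxl.
have dk : (mdeg m < k)%N by rewrite leq_maxr.
have E := etrans (congr1 (mcoeff m) (pihomog_partitionE pk)) (raddf_sum (mcoeff m) _ _ _).
rewrite [RHS]E (bigD1 (Ordinal dk)) //= [X in _ = _ + X]big1 ?addr0 // => i.
rewrite -val_eqE /= => im; apply: (dhomog_nemf_coeff (pihomogP mdeg i p)).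
by rewrite eq_sym.
Qed.

Lemma pihomog_order_ge d e (p : R) : order_ge d p -> (e < d)%N -> pihomog mdeg e p = 0.
Proof.
move=> hp ed; apply/mpolyP=> m; rewrite mcoeff_pihomog mcoeff0.
by case: eqP => // me; rewrite hp // me.
Qed.

(** The ideals I + (M ∩ m^d) decrease, hence are constant from some d0 on. An element of M divisible
    by X_i^d0 then lies in I + (M ∩ m^k) for every larger k, and comparison of homogeneous
    components puts it in I. *)
Lemma variable_nilpotent I M l : graded_ideal I -> graded_ideal M ->
  is_length I M l -> exists D, forall i p, M p -> I ('X_i ^+ D * p).
Proof.
move=> [hI gI] [hM gM] h; have IM := len_sub h.
pose D d := sumset I (M `&` order_ge d).
have hD d : is_ideal (D d).
  by apply: ideal_sumset => //; apply: idealI => //; exact: order_ge_ideal.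
have [|d|d0 stab] := len_stable (@ideal_modular _) (D := D) h.
- move=> d; split=> //.
    apply: (sumsetl (@ideal_modular _)); apply: idealI => //; exact: order_ge_ideal.
  by apply: (sumset_sub (@ideal_modular _)) => // p [].
- move=> _ [p [q [hp [hq qd] ->]]]; exists p, q; split=> //; split=> // m hm.
  by apply: qd; exact: leqW.
exists d0 => i p hp; set q := _ * p.
have hq : M q by exact: idealM.
have Dq : D d0 q.
  exists 0, q; split; [exact: ideal0| |by rewrite add0r]; split=> //.
  rewrite /q mulrC; apply: (idealM _ (order_ge_ideal d0)); apply: order_ge_homog.
  have := dhomogMn d0 (@lform_homog K n (delta_mx 0 i)).
  by rewrite lform_delta mul1n.
(* Beyond the degree of q: all components of q are in degrees below k, where the summand in m^k
   contributes nothing. *)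
pose k := maxn d0 (msize q).
move: Dq; rewrite -(stab k) ?leq_maxl // => -[u [v [hu [hv vk] qE]]].
rewrite (pihomog_partitionE (mf := mdeg) (p := q) (leq_maxr d0 (msize q))).
apply: ideal_sum => // -[e ek] _ /=.
rewrite qE linearD /= [X in _ + X](pihomog_order_ge vk) ?addr0; last exact: ek.
exact: gI.
Qed.

(** Modulo I, multiplying an element of M by a polynomial is scaling by its constant term. *)
Lemma killed_subsp_ideal I M (S : set R) : is_ideal M ->
  (forall i p, M p -> I ('X_i * p)) -> subsp S -> I `<=` S -> S `<=` M -> is_ideal S.
Proof.
move=> hM kill hS IS SM; have [S0 SD SZ] := hS; split=> // a p hp.
have hL q : M q -> forall i, S ('X_i * q) by move=> hq i; apply: IS; exact: kill.
suff h : forall b, S (b * p) by exact: h.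
move=> b; rewrite (mpolyE b) mulr_suml; apply: subsp_sum => // m _.
rewrite -scalerAl; apply: SZ.
case: (eqVneq m 0%MM) => [->|m0]; first by rewrite mpolyX0 mul1r.
have [i mi] : exists i, m i != 0%N.
  apply: contrapT => h; case/eqP: m0; apply/mnmP => i; rewrite mnm0E.
  by apply/eqP/negPn/negP => mi; apply: h; exists i.
have <- : (U_(i) + (m - U_(i)))%MM = m by rewrite addmC submK // lep1mP.
by rewrite mpolyXD -mulrA; apply: hL; apply: idealM => //; exact: SM.
Qed.

(* A simple subquotient of M/I is killed by every variable, since the variables
   act nilpotently; hence it has no proper subspace either. *)
Lemma len_ideal_subsp I M l : (exists D, forall i p, M p -> I ('X_i ^+ D * p)) ->
  is_length I M l -> len (@subsp K R) I M l.
Proof.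
elim: l I => [|l IH] I [D nil] h.
  have IM := len0 h; rewrite IM; apply: len_refl; apply: ideal_subsp.
  by have [] := lenC h.
have [J [hIJ hJM [IJ nJI]]] := len_peel (@ideal_modular _) h.
have [hI hJ] := lenC hIJ; have JM := len_sub hJM.
rewrite -add1n; apply: (len_add (@subsp_modular _ _) (L := J)); last first.
  by apply: IH => //; exists D => i p hp; apply: IJ; exact: nil.
split; first by apply: chain1; [exact: ideal_subsp..|].
have kill i p : J p -> I ('X_i * p).
  move=> Jp; apply: contrapT => nIp.
  (* If X_i p is outside I, then L is all of J, since J/I has length 1; so p is congruent modulo I
     to some r X_i p. *)
  pose L := sumset I (ideal_gen [set 'X_i * p]).
  have hz := @ideal_gen_ideal _ [set ('X_i * p : R)].
  have hL : is_ideal L by exact: ideal_sumset.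
  have IL : I `<=` L by exact: (sumsetl (@ideal_modular _)).
  have LJ : L `<=` J.
    apply: (sumset_sub (@ideal_modular _)) => //; apply: ideal_gen_sub => // _ ->.
    exact: idealM.
  have Lp : L p.
    apply: contrapT => nLp.
    have c2 : chain (@is_ideal _) I J 2.
      apply: (@chain_cat _ _ _ L _ 1 1); apply: chain1 => //; split=> //.
        move/(_ ('X_i * p)) => H; apply: nIp; apply: H.
        by apply: (sumsetr (@ideal_modular _)) => //; exact: sub_ideal_gen.
      by move/(_ p Jp).
    by have := hIJ.2 _ c2.
  have [u [_ [hu /ideal_gen1[r ->] pE]]] := Lp.
  (* Iterating the congruence up to the nilpotency exponent forces p into I. *)
  have step k : I (p - (r * 'X_i) ^+ k * p).
    elim: k => [|k IHk]; first by rewrite expr0 mul1r subrr; exact: ideal0.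
    have -> : p - (r * 'X_i) ^+ k.+1 * p =
       (p - (r * 'X_i) ^+ k * p) + (r * 'X_i) ^+ k * (p - r * 'X_i * p).
      by rewrite mulrBr addrA subrK exprSr !mulrA.
    apply: idealD => //; apply: idealM => //.
    by rewrite {1}pE mulrA addrK.
  apply: nIp; apply: idealM => //; rewrite -(subrK ((r * 'X_i) ^+ D * p) p).
  apply: idealD => //; rewrite exprMn -mulrA; apply: idealM => //; apply: nil.
  exact: JM.
(* Every subspace between I and J is now an ideal, so a chain of subspaces is a chain of ideals. *)
move=> k [F [F0 Fk FC FS]]; apply: hIJ.2; exists F; split=> // j jk.
have Fn := nested (fun k hk => properW (FS k hk)).
apply: (killed_subsp_ideal hJ kill (FC j jk)).
  by rewrite -F0; apply: Fn.
by rewrite -Fk; apply: Fn; rewrite jk /=.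
Qed.

End GradedLength.

(** Gaussian elimination at a0 gives P and Q with P A(a0) Q the identity of size r. The determinant
    of P A(a) Q is polynomial in a, and where it is nonzero A(a) has rank at least r. *)
Lemma rank_lower_semicontinuous (K : fieldType) n h (A : 'rV[K]_n -> 'M[K]_h)
    (a0 : 'rV[K]_n) : (forall i j, polyfun (fun a => A a i j)) ->
  exists2 g : 'rV[K]_n -> K, polyfun g &
    g a0 != 0 /\ forall a, g a != 0 -> (\rank (A a0) <= \rank (A a))%N.
Proof.
move=> pA; set r := \rank (A a0).
pose P : 'M[K]_(r, h) := pid_mx r *m invmx (col_ebase (A a0)).
pose Q : 'M[K]_(h, r) := invmx (row_ebase (A a0)) *m pid_mx r.
exists (fun a => \det (P *m A a *m Q)).
  apply: polyfun_det => i j.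
  have -> : (fun a => (P *m A a *m Q) i j) =
     fun a => \sum_k (\sum_l P i l * A a l k) * Q k j.
    by apply/funext=> a; rewrite mxE; apply: eq_bigr => k _; rewrite mxE.
  apply: polyfun_sum => k; apply: polyfunM; last exact: polyfun_const.
  by apply: polyfun_sum => l; apply: polyfunM; [exact: polyfun_const|exact: pA].
have rh : (r <= h)%N by exact: rank_leq_row.
split.
  have -> : P *m A a0 *m Q = 1%:M.
    rewrite -{1}(mulmx_ebase (A a0)) -/r /P /Q !mulmxA mulmxKV ?col_ebase_unit //.
    rewrite -(mulmxA _ (row_ebase _)) mulmxV ?row_ebase_unit // mulmx1.
    by rewrite !(mul_pid_mx, minnn, minn_idPr rh) pid_mx_1.
  by rewrite det1 oner_neq0.
move=> a; rewrite -unitfE => da.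
have : (P *m A a *m Q) \in unitmx by rewrite unitmxE.
rewrite -row_full_unit => /eqP <-.
apply: leq_trans (mxrankM_maxl _ _) _; exact: mxrankM_maxr.
Qed.

Section GenericTValue.
Variables (K : fieldType) (n : nat).
Local Notation R := {mpoly K[n]}.
Implicit Types (I N : set R).

(** X(a) is the matrix of multiplication by [lform a] on N/I; [T] holds the coordinates of each
    basis element times each variable, so the entries are linear in a. With coordinates as rows, the
    kernel of multiplication is the left kernel [kermx]. *)
Lemma colon_length_matrix I N h : is_ideal I -> is_ideal N ->
  len (@subsp K R) I N h ->
  exists2 X : 'rV[K]_n -> 'M[K]_h, (forall i j, polyfun (fun a => X a i j)) &
    forall a l, colon I (lform a) `<=` N ->
      len (@subsp K R) I (colon I (lform a)) l -> l = \rank (kermx (X a)).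
Proof.
move=> hI hN hl; have [e [eN eG eI]] := len_basis hl.
have sI := ideal_subsp hI; have sN := ideal_subsp hN.
have /choice[T hT] (jk : 'I_h * 'I_n) : exists c, I (e jk.1 * 'X_(jk.2) - lcomb c e).
  by apply: eG; exact: idealMr.
pose X (a : 'rV[K]_n) : 'M[K]_h := \matrix_j \sum_k a 0 k *: T (j, k).
have hX a j : I (e j * lform a - lcomb (row j (X a)) e).
  have -> : lcomb (row j (X a)) e = \sum_k a 0 k *: lcomb (T (j, k)) e.
    rewrite rowK /lcomb; under eq_bigr => i _ do rewrite summxE scaler_suml.
    rewrite exchange_big /=; apply: eq_bigr => k _; rewrite scaler_sumr.
    by apply: eq_bigr => i _; rewrite mxE scalerA.
  rewrite /lform mulr_sumr -sumrB; apply: ideal_sum => // k _.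
  by rewrite -scalerAr -scalerBr; case: sI => _ _; apply; exact: (hT (j, k)).
have hXc a (c : 'rV_h) : I (lcomb c e * lform a - lcomb (c *m X a) e).
  rewrite lcomb_mul /lcomb mulr_suml -sumrB; apply: ideal_sum => // j _.
  by rewrite -scalerAl -scalerBr; case: sI => _ _; apply; exact: hX.
exists X.
  move=> i j; have -> : (fun a => X a i j) = fun a => \sum_k a 0 k * T (i, k) 0 j.
    by apply/funext=> a; rewrite mxE summxE; apply: eq_bigr => k _; rewrite mxE.
  apply: polyfun_sum => k; apply: polyfunM; [exact: polyfun_coord|exact: polyfun_const].
move=> a l aN hla; have hIa := colon_ideal (lform a) hI.
apply/eqP; rewrite eqn_leq; apply/andP; split.
  have [f [fM fG fI]] := len_basis hla.
  have /choice[F hF] k : exists c, I (f k - lcomb c e) by apply: eG; exact: aN.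
  pose A := \matrix_k F k.
  have rA : row_free A.
    apply: inj_row_free => c cA; apply: fI.
    have : lcomb (c *m A) e = 0 by rewrite cA /lcomb big1 // => i _; rewrite mxE scale0r.
    rewrite lcomb_mul => e0; rewrite -[lcomb c f]subr0 -e0 /lcomb -sumrB.
    apply: subsp_sum => // i _; rewrite -scalerBr rowK.
    by case: sI => _ _; apply; exact: hF.
  have <- : \rank A = l by apply/eqP.
  apply: mxrankS; apply/sub_kermxP/row_matrixP => k; rewrite row0 row_mul rowK.
  apply: eI; rewrite -[lcomb _ e](subKr (lcomb (F k) e * lform a)).
  apply: idealB => //; rewrite -[lcomb _ _](subrK (f k)) mulrDl.
  apply: idealD => //; last exact: fM.
  by apply: idealMr => //; rewrite -opprB; exact: idealN.
(* Conversely, a basis of the left kernel gives elements of the colon ideal independent modulo I. *)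
set G := row_base (kermx (X a)).
apply: (independent_le (f := fun k => lcomb (row k G) e) hla).
  move=> k; rewrite /colon /=.
  have := hXc a (row k G); rewrite -row_mul.
  have -> : G *m X a = 0 by apply/sub_kermxP; rewrite eq_row_base.
  by rewrite row0 {2}/lcomb big1 ?subr0 // => i _; rewrite mxE scale0r.
move=> c; rewrite -lcomb_mul => /eI cG; apply: (row_free_inj (row_base_free (kermx (X a)))).
by rewrite -/G cG mul0mx.
Qed.

Lemma t_value_generic (hK : infinite_set [set: K]) I t : graded_ideal I ->
  is_t_value I t -> generic (fun a : 'rV[K]_n => is_length I (colon I (lform a)) t).
Proof.
move=> gI [[a0 h0] tmin]; have hI := gI.1; set z := lform a0.
(* C k is I : z^k, where z attains the minimum. *)
pose C k := iter k (fun J => colon J z) I.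
have gC k : graded_ideal (C k) by elim: k => // k IH; exact: graded_colon.
have hC k := (gC k).1.
have CS k : C k `<=` C k.+1 by exact: sub_colon.
have hl k : exists l, is_length (C k) (C k.+1) l.
  elim: k => [|k [l hl]]; first by exists t.
  (* Multiplication by z identifies C (k+2)/C (k+1) with A/C k, a submodule of C (k+1)/C k, so
     finiteness propagates. *)
  pose A := sumset (C k) (C k.+1 `&` ideal_gen [set z]).
  have hz := @ideal_gen_ideal _ [set z].
  have hA : is_ideal A by apply: ideal_sumset => //; exact: idealI.
  have CA : C k `<=` A by apply: (sumsetl (@ideal_modular _)); exact: idealI.
  have AC : A `<=` C k.+1 by apply: (sumset_sub (@ideal_modular _)) => // p [].
  have [x [_ [hx _ _]]] := len_split (@ideal_modular _) hA CA AC hl.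
  by exists x; apply/(len_colon z x (hC k) (hC k.+1) (CS k)).
have hIl k : exists l, is_length I (C k) l.
  elim: k => [|k [l hk]]; first by exists 0%N; exact: len_refl.
  by have [l' hk'] := hl k; exists (l + l')%N; exact: (len_add (@ideal_modular _) hk hk').
have [k Ck] := ideal_acc hC CS.
have [h hIN] := hIl k.
set N := C k in Ck hIN; have IN := len_sub hIN.
have nil := variable_nilpotent gI (gC k) hIN.
have hsub := len_ideal_subsp nil hIN.
have [X pX hX] := colon_length_matrix hI (hC k) hsub.
have [g pg [g0 grank]] := rank_lower_semicontinuous a0 pX.
have sublen a l : colon I (lform a) `<=` N -> is_length I (colon I (lform a)) l ->
    l = \rank (kermx (X a)).
  move=> aN hla; apply: hX => //; apply: len_ideal_subsp hla.
  by have [D hD] := nil; exists D => i p /aN; exact: hD.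
have gen_rank : generic (fun a : 'rV[K]_n => (\rank (X a0) <= \rank (X a))%N).
  by apply/genericP; exists g; split=> //; exists a0.
have gen_nzd := nonzerodivisor_generic (hC k) (esym Ck).
apply: generic_imp (generic_and hK gen_rank gen_nzd) => a [ra na].
have aN : colon I (lform a) `<=` N by rewrite -[N]na; exact: colonS.
have a0N : colon I (lform a0) `<=` N by rewrite [N]Ck; exact: colonS.
have [l [_ [hla _ _]]] := len_split (@ideal_modular _) (colon_ideal _ hI) (sub_colon _ hI) aN hIN.
suff -> : t = l by [].
(* Minimality of t gives one inequality; rank at a at least that at a0 means a kernel no larger,
   which gives the other. *)
apply/eqP; rewrite eqn_leq (tmin _ _ hla) /= (sublen _ _ aN hla) (sublen _ _ a0N h0).
by rewrite !mxrank_ker leq_sub2l.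
Qed.

End GenericTValue.

(** * The induction *)

Section TSequence.
Variable K : fieldType.
Implicit Types n : nat.

(** The condition under the quantifier of [is_t_sequence], isolated so that it can be transferred
    for one tuple at a time. *)
Definition t_sequence_at n (I : set {mpoly K[n]}) (t : 'I_n -> nat) (Z : 'M[K]_n) : Prop :=
  ideal_gen (range (fun k : 'I_n => lform (row k Z))) = @max_ideal K n /\
  forall i : 'I_n, exists phi : {lrmorphism {mpoly K[n]} -> {mpoly K[i.+1]}},
    graded_quotient
      (ideal_gen [set lform (row k Z) | k in [set k : 'I_n | (i < k)%N]]) phi /\
    is_t_value (phi @` I) (t i).

Lemma t_value_setT n t : is_t_value (@setT {mpoly K[n]}) t -> t = 0%N.
Proof.
move=> [_ h]; apply/eqP; rewrite -leqn0; apply: (h 0).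
exact: len_refl (@idealT {mpoly K[n]}).
Qed.

Lemma t_sequence_setT n (t : 'I_n -> nat) i :
  is_t_sequence (@setT {mpoly K[n]}) t -> t i = 0%N.
Proof.
case/generic_ex=> Z [_ /(_ i)[phi [[ps _ _] ht]]].
by rewrite ps in ht; exact: t_value_setT ht.
Qed.

Lemma t_sequence_last n (I : set {mpoly K[n.+1]}) t : is_ideal I ->
  is_t_sequence I t -> is_t_value I (t ord_max).
Proof.
move=> hI /generic_ex[Z [_ /(_ ord_max)[phi [gq ht]]]].
apply: t_value_iso hI ht.
suff <- : ideal_gen [set lform (row k Z) | k in [set k : 'I_n.+1 | (n < k)%N]] = [set 0] by exact: gq.
apply/seteqP; split.
  apply: ideal_gen_sub; last by move=> q [k nk _]; move: (ltn_ord k); rewrite ltnS leqNgt nk.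
  by split=> [//|p q /= -> ->|p q /= ->]; rewrite ?addr0 ?mulr0.
by move=> _ ->; exact: ideal0 (@ideal_gen_ideal _ _).
Qed.

(** * Passing from a tuple of forms to its image modulo the last form *)

Section Restrict.
Variables (n : nat) (Z : 'M[K]_n.+1) (W : 'M[K]_n).
Variable phi : {lrmorphism {mpoly K[n.+1]} -> {mpoly K[n]}}.
Hypothesis gq : graded_quotient (ideal_gen [set lform (row ord_max Z)]) phi.
Local Notation wid := (widen_ord (leqnSn n)).
Hypothesis phiW : forall k : 'I_n, phi (lform (row (wid k) Z)) = lform (row k W).

(** The last row goes to 0 and the others to the rows of W. A predicate on natural numbers covers
    both all rows and the rows after a given index. *)
Lemma image_row_ideal (P : nat -> Prop) :
  phi @` ideal_gen [set lform (row k Z) | k in [set k : 'I_n.+1 | P k]] =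
  ideal_gen [set lform (row k W) | k in [set k : 'I_n | P k]].
Proof.
have [ps pk _] := gq.
rewrite image_ideal_gen //; apply/seteqP; split; last first.
  have WZ : [set lform (row k W) | k in [set k : 'I_n | P k]] `<=`
      phi @` [set lform (row k Z) | k in [set k : 'I_n.+1 | P k]].
    by move=> _ [k Pk <-]; exists (lform (row (wid k) Z)) => //; exists (wid k).
  exact: (ideal_genS WZ).
have hJ := @ideal_gen_ideal _ [set lform (row k W) | k in [set k : 'I_n | P k]].
apply: ideal_gen_sub => // _ [_ [k Pk <-] <-].
case: (unliftP ord_max k) Pk => [j ->|->] Pk.
  have e : lift ord_max j = wid j by apply: ord_inj; rewrite lift_max.
  rewrite e in Pk *; have /sub_ideal_gen : [set lform (row k W) | k in [set k : 'I_n | P k]] (lform (row j W)).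
    by exists j.
  by rewrite -phiW; exact.
have : ideal_gen [set lform (row ord_max Z)] (lform (row ord_max Z)) by exact: sub_ideal_gen.
by rewrite -pk /= => e; move: (ideal0 hJ); rewrite -{1}e; exact.
Qed.

(** The last form is among those divided out in each ring of index below n, so these rings are also
    the rings attached to W in the quotient. *)
Lemma t_sequence_at_quotient (I : set {mpoly K[n.+1]}) t :
  t_sequence_at I t Z -> t_sequence_at (phi @` I) (t \o wid) W.
Proof.
have [ps pk ph] := gq.
move=> [hm ht]; split.
  rewrite -(image_row_ideal (fun=> True)) [ideal_gen _]hm !max_idealE.
  apply/seteqP; split=> [_ [p hp <-]|q hq]; first by rewrite /= graded_mcoeff0.
  have [p _ pq] : range phi q by rewrite ps.
  by exists p => //=; rewrite -(graded_mcoeff0 ph) pq.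
move=> i; have [theta [tq tt]] := ht (wid i).
have sub : ideal_gen [set lform (row ord_max Z)] `<=`
    ideal_gen [set lform (row k Z) | k in [set k : 'I_n.+1 | (wid i < k)%N]].
  by apply: ideal_genS => _ ->; exists ord_max => //=.
have [psi pq psiE] := graded_factor gq tq sub.
exists psi; split; first by rewrite -(image_row_ideal (fun k => (i < k)%N)).
suff -> : psi @` (phi @` I) = theta @` I by exact: tt.
apply/seteqP; split=> [_ [_ [p hp <-] <-]|_ [p hp <-]]; first by exists p.
by exists (phi p); [exists p|].
Qed.

End Restrict.

(** A form that is a multiple r z of z equals r(0) z, by comparison of degree 1 components. *)
Lemma quotient_lform_kernel n m (phi : {lrmorphism {mpoly K[n]} -> {mpoly K[m]}})
    (a b : 'rV[K]_n) :
  graded_quotient (ideal_gen [set lform a]) phi -> phi (lform b) = 0 ->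
  exists c, b = c *: a.
Proof.
move=> [_ pk _] hb; have : (phi @^-1` [set 0]) (lform b) by [].
rewrite pk => /ideal_gen1[r hr]; exists (r@_0); apply: lform_inj.
have := pihomogM 0 r (lform_homog a); rewrite -hr add0n pihomog_dE; last exact: lform_homog.
by move=> ->; rewrite pihomog0E mul_mpolyC linearZ.
Qed.

(** Freezing the first n rows of a good tuple Z0 at [B0] turns its open condition into one on the
    last form a. For such an a, the tuples W of the quotient whose lift, completed by a, is good
    form an open set, nonempty because the image of [B0] belongs to it. *)
Lemma t_sequence_quotient n (I : set {mpoly K[n.+1]}) t : is_t_sequence I t ->
  generic (fun a : 'rV[K]_n.+1 =>
    forall phi : {lrmorphism {mpoly K[n.+1]} -> {mpoly K[n]}},
      graded_quotient (ideal_gen [set lform a]) phi ->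
      is_t_sequence (phi @` I) (t \o widen_ord (leqnSn n))).
Proof.
case/genericP=> g [pg [Z0 gZ0] hg].
pose mk (B : 'M[K]_(n, n.+1)) (a : 'rV[K]_n.+1) : 'M[K]_n.+1 :=
  \matrix_(k, j) if unlift ord_max k is Some k' then B k' j else a 0 j.
have widE k : widen_ord (leqnSn n) k = lift ord_max k.
  by apply: ord_inj; rewrite lift_max.
have mk_wid B a k : row (widen_ord (leqnSn n) k) (mk B a) = row k B.
  by apply/rowP=> j; rewrite !mxE widE liftK.
have mk_max B a : row ord_max (mk B a) = a.
  by apply/rowP=> j; rewrite !mxE unlift_none.
pose B0 := \matrix_(k < n) row (lift ord_max k) Z0.
apply/genericP; exists (g \o mk B0); split.
- apply: polyfun_comp => // i j.
  have -> : (fun a => mk B0 a i j) =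
      fun a => if unlift ord_max i is Some k then B0 k j else a 0 j.
    by apply/funext=> a; rewrite mxE.
  by case: (unlift ord_max i) => [k|]; [exact: polyfun_const|exact: polyfun_coord].
- exists (row ord_max Z0); rewrite /=; have -> : mk B0 (row ord_max Z0) = Z0; last exact: gZ0.
  by apply/matrixP=> k j; rewrite mxE; case: (unliftP ord_max k) => [k' ->|->]; rewrite !mxE.
move=> a /= ga phi gq; have [ps pk ph] := gq.
have [S hS] := lift_section ph ps.
have /choice[b hb] k : exists b, phi (lform (row k B0)) = lform b by exact: graded_lform.
(* A row of [B0] and the lift of its image agree under phi, so they differ by a multiple of a. *)
have /choice[c hc] k : exists c, row k B0 - b k *m S = c *: a.
  apply: quotient_lform_kernel gq _.
  by rewrite (raddfB (@lform K n.+1)) rmorphB /= hS hb subrr.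
pose lift_rows (W : 'M[K]_n) : 'M[K]_(n, n.+1) := W *m S + (\col_k c k) *m a.
(* The lifts are translated by multiples of a so that they pass through the
   point B0 where g does not vanish; phi does not see the translation. *)
apply/genericP; exists (fun W => g (mk (lift_rows W) a)); split.
- apply: (@polyfun_comp _ _ _ _ _ g (fun W => mk (lift_rows W) a)) => // i j.
  have -> : (fun W => mk (lift_rows W) a i j) =
      fun W => if unlift ord_max i is Some k
        then \sum_l W k l * S l j + ((\col_k c k) *m a) k j else a 0 j.
    by apply/funext=> W; rewrite mxE; case: (unlift _ _) => // k; rewrite 2!mxE.
  case: (unlift ord_max i) => [k|]; last exact: polyfun_const.
  apply: polyfunD; last exact: polyfun_const.
  by apply: polyfun_sum => l; apply: polyfunM; [exact: polyfun_coord|exact: polyfun_const].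
- exists (\matrix_k b k); suff -> : lift_rows (\matrix_k b k) = B0 by [].
  apply/row_matrixP=> k; rewrite raddfD /= !row_mul rowK.
  have -> : row k (\col_k c k) = (c k)%:M by apply/rowP=> j; rewrite !mxE ord1 eqxx.
  by rewrite mul_scalar_mx -hc addrC subrK.
move=> W /hg hW; apply: (t_sequence_at_quotient (Z := mk (lift_rows W) a)) hW.
  by rewrite mk_max.
move=> k; rewrite mk_wid raddfD /= !row_mul.
have -> : row k (\col_k c k) = (c k)%:M by apply/rowP=> j; rewrite !mxE ord1 eqxx.
rewrite mul_scalar_mx (raddfD (@lform K n.+1)) rmorphD /= hS.
have -> : phi (lform (c k *: a)) = 0; last by rewrite addr0.
rewrite !linearZ /=; have : (phi @^-1` [set 0]) (lform a) by rewrite pk; exact: sub_ideal_gen.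
by move=> /= ->; rewrite scaler0.
Qed.

Lemma max_mul_sub n (I : set {mpoly K[n]}) :
  ideal_mul (@max_ideal K n) I `<=` @max_ideal K n.
Proof.
have hm : is_ideal (@max_ideal K n) by exact: ideal_gen_ideal.
by apply: ideal_gen_sub => // _ [p [q [hp _ ->]]]; exact: (idealMr _ hm).
Qed.

Lemma max_ideal0 (p : {mpoly K[0]}) : @max_ideal K 0 p -> p = 0.
Proof.
rewrite max_idealE /= => p0; apply/mpolyP=> m; rewrite mcoeff0.
by have -> : m = 0%MM by apply/mnmP => -[].
Qed.

Lemma max_ideal_lform n (a : 'rV[K]_n) : @max_ideal K n (lform a).
Proof. by rewrite max_idealE; exact: mcoeff0_lform. Qed.

Lemma max_ideal_proper n : ~ @max_ideal K n 1.
Proof. by rewrite max_idealE /= mcoeff1 eqxx => /eqP; rewrite oner_eq0. Qed.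

(* If mI : z = I then I : z is the socle colon I : m, the smallest of all I : y. *)
Lemma m_full_t_value n (I : set {mpoly K[n]}) t (a : 'rV[K]_n) : is_ideal I ->
  is_t_value I t -> colon (ideal_mul (@max_ideal K n) I) (lform a) = I ->
  is_length I (colon I (lform a)) t.
Proof.
move=> hI [[b hb] tmin] mf.
have sub : colon I (lform a) `<=` colon I (lform b).
  move=> p hp; rewrite /colon /= -[X in X _]mf /colon /= mulrAC mulrC.
  by apply: mem_ideal_mul; [exact: max_ideal_lform|exact: hp].
have [l [r [hl _ lr]]] := len_split (@ideal_modular _) (colon_ideal _ hI) (sub_colon _ hI) sub hb.
suff -> : t = l by [].
by apply/eqP; rewrite eqn_leq (tmin _ _ hl) -lr leq_addr.
Qed.

(** The bound is proved together with the equivalence because equality of the two sums forces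
    equality of the summands only when each summand is bounded. It excludes R, for which the
    t-values vanish but mu is positive. *)
Lemma m_full_iff_mu (hK : infinite_set [set: K]) n (I : set {mpoly K[n]}) (t : 'I_n -> nat) :
  graded_ideal I -> is_t_sequence I t ->
  (I <> setT -> exists2 k, (k <= \sum_(i < n) t i)%N & is_mu I k) /\
  (completely_m_full I <-> is_mu I (\sum_(i < n) t i)%N).
Proof.
elim: n I t => [|n IH] I t gI ht; have hI := gI.1.
  rewrite big_ord0.
  have mu0 : I = [set 0] -> is_mu I 0.
    move=> I0; rewrite /is_mu.
    have -> : ideal_mul (@max_ideal K 0) I = I; last exact: len_refl.
    apply/seteqP; split; first exact: ideal_mul_sub.
    by rewrite {1}I0 => _ ->; exact: ideal0 (ideal_mul_ideal _ _).
  have I0 : I `<=` @max_ideal K 0 -> I = [set 0].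
    by move=> Im; apply/seteqP; split=> [p /Im /max_ideal0 //|_ ->]; exact: ideal0.
  split=> [nT|]; first by exists 0%N => //; apply/mu0/I0; exact: graded_proper.
  split; first exact: mu0.
  by move=> /len0 e; apply: I0; rewrite -e; exact: max_mul_sub.
have tl := t_sequence_last hI ht.
rewrite big_ord_recr /=; set S := (\sum_(i < n) _)%N; set tm := t ord_max in tl *.
have gen_seq := t_sequence_quotient ht.
set mI := ideal_mul (@max_ideal K n.+1) I.
have full_mu : completely_m_full I -> is_mu I (S + tm).
  move=> [_ /(generic_and hK gen_seq) /generic_ex[a [hseq [mf [phi [gq hphi]]]]]].
  apply/(mu_split _ hI gq); exists S, tm; split=> //; last first.
    by rewrite mf; exact: m_full_t_value.
  have [ps _ ph] := gq.
  by apply/(IH _ _ (graded_image ph ps gI) (hseq _ gq)).2.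
case: (pselect (I = setT)) => [IT|nT].
  split=> //; split=> // mu; exfalso.
  have t0 i : t i = 0%N by apply: t_sequence_setT; rewrite -IT.
  move: mu; rewrite /S /tm t0 big1 => [|i _]; last exact: t0.
  move/len0 => e; apply: (@max_ideal_proper n.+1); apply: (max_mul_sub (I := I)).
  by rewrite e IT.
have gen_nz : generic (fun a : 'rV[K]_n.+1 => a != 0).
  apply/genericP; exists (fun a => a 0 0); split; first exact: polyfun_coord.
    by exists (const_mx 1); rewrite mxE oner_neq0.
  by move=> a; apply: contraNneq => ->; rewrite mxE.
have gen := generic_and hK (generic_and hK gen_seq gen_nz) (t_value_generic hK gI tl).
have main a : (forall phi : {lrmorphism {mpoly K[n.+1]} -> {mpoly K[n]}},
      graded_quotient (ideal_gen [set lform a]) phi ->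
      is_t_sequence (phi @` I) (t \o widen_ord (leqnSn n))) -> a != 0 ->
    is_length I (colon I (lform a)) tm ->
    exists2 k, (k <= S + tm)%N & is_mu I k /\ (k = (S + tm)%N ->
      colon mI (lform a) = I /\
      exists phi : {lrmorphism {mpoly K[n.+1]} -> {mpoly K[n]}},
        graded_quotient (ideal_gen [set lform a]) phi /\ completely_m_full (phi @` I)).
  move=> hseq a0 ha; have [phi gq] := quotient_exists a0; have [ps _ ph] := gq.
  have [] := IH _ _ (graded_image ph ps gI) (hseq _ gq).
  rewrite -/S => muS fullS.
  have [|k kS hk] := muS.
    (* The image of a proper graded I is proper, since phi preserves constant terms. *)
    move=> /seteqP[_ /(_ 1 Logic.I)[p /(graded_proper gI nT)]].
    rewrite max_idealE /= -(graded_mcoeff0 ph) => p0 p1.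
    by apply: (@max_ideal_proper n); rewrite max_idealE /= -p1.
  have hmI : is_ideal mI by exact: ideal_mul_ideal.
  have ImI : I `<=` colon mI (lform a).
    move=> p hp; rewrite /colon /= mulrC.
    by apply: mem_ideal_mul => //; exact: max_ideal_lform.
  (* Here x is the length of (mI:z)/I and x + q is the last t-value; equality in the bound forces x
     = 0, hence mI:z = I. *)
  have [x [q [hx hq xq]]] := len_split (@ideal_modular _) (colon_ideal (lform a) hmI) ImI
    (colonS (ideal_mul_sub hI)) ha.
  have qt : (q <= tm)%N by rewrite -xq leq_addl.
  exists (k + q)%N; first exact: leq_add.
  split; first by apply/(mu_split _ hI gq); exists k, q.
  move=> e.
  have kE : k = S.
    by apply/eqP; rewrite eqn_leq kS -(leq_add2r tm) -e leq_add2l.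
  have x0 : x = 0%N.
    move: e; rewrite kE => /addnI qE; apply/eqP; rewrite -(eqn_add2r q) xq add0n qE //.
  split; first by rewrite x0 in hx; rewrite -(len0 hx).
  by exists phi; split=> //; apply/fullS; rewrite -kE.
split.
  move=> _; have [a [[hseq a0] ha]] := generic_ex gen.
  by have [k kS [hk _]] := main a hseq a0 ha; exists k.
split=> // mu; split=> //.
(* Since mu is unique, every general form falls under the equality case. *)
apply: generic_imp gen => a [[hseq a0] ha] /=.
have [k _ [hk h]] := main a hseq a0 ha; apply: h.
exact: len_uniq hk mu.
Qed.

End TSequence.

Theorem theorem4p1 (K : fieldType) (hK : infinite_set [set: K])
    (n : nat) (hn : (0 < n)%N) (I : set {mpoly K[n]}) (hI : graded_ideal I)
    (t : 'I_n -> nat) (ht : is_t_sequence I t) :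
  completely_m_full I <-> is_mu I (\sum_(i < n) t i)%N.
Proof. exact: (m_full_iff_mu hK hI ht).2. Qed.
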